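(* Let $X$ be an $L$-dimensional zero-mean Gaussian random vector with covariance $\Sigma_X\succ0$, let $D\ge 0$, $P\ge 0$, and let the perception metric $\phi$ be either the KL divergence $\phi(P_X,P_{\hat X})=D(P_{\hat X}\|P_X)$ or the squared Wasserstein-2 distance $\phi(P_X,P_{\hat X})=W_2^2(P_X,P_{\hat X})$. Then in the optimization problem $$R(D,P)=\inf\{I(X;\hat X): P_{\hat X|X} \text{ with } \mathbb{E}[\|X-\hat X\|^2]\le D,\ \phi(P_X,P_{\hat X})\le P\},$$ one may, without loss of optimality, restrict to reconstructions $\hat X$ that have mean zero and are jointly Gaussian with $X$; i.e., the infimum is unchanged when restricted to such $P_{\hat X|X}$.
   Context: $\hat X$ takes values in $\mathbb{R}^L$. $D(P_{\hat X}\|P_X)=\int P_{\hat X}(x)\log\frac{P_{\hat X}(x)}{P_X(x)}dx$ (natural log) and $W_2^2(P_X,P_{\hat X})=\inf\mathbb{E}[\|U-V\|^2]$ over all couplings of $(U,V)$ with marginals $P_X$ and $P_{\hat X}$. *)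

(* Defs.v *)
From HB Require Import structures.
From mathcomp Require Import all_boot all_order all_algebra.
From mathcomp Require Import all_classical all_reals all_analysis.
Set Implicit Arguments. Unset Strict Implicit. Unset Printing Implicit Defensive.
Import Order.TTheory GRing.Theory Num.Theory.
Local Open Scope classical_set_scope.
Local Open Scope ring_scope.

(** R^L is represented by L.-tuple R, with the product (= Borel) sigma-algebra
    provided by MathComp-Analysis. *)
Definition vec (R : realType) (L : nat) := (L.-tuple R)%type.

Section vecops.
Context {R : realType} {L : nat}.
Definition dotv (a x : vec R L) : R := \sum_(i < L) tnth a i * tnth x i.
Definition sqdist (x y : vec R L) : R := \sum_(i < L) (tnth x i - tnth y i) ^+ 2.
Definition quadform (S : 'M[R]_L) (a : vec R L) : R :=
  \sum_(i < L) \sum_(j < L) tnth a i * S i j * tnth a j.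
Definition posdef (S : 'M[R]_L) : Prop :=
  S^T = S /\ forall a : vec R L, (exists i, tnth a i != 0) -> 0 < quadform S a.
End vecops.

(** fst / snd as measurable functions (to take marginals with [distribution]). *)
Section projs.
Context d1 d2 (T1 : measurableType d1) (T2 : measurableType d2).
Definition pfst : T1 * T2 -> T1 := fst.
Definition psnd : T1 * T2 -> T2 := snd.
HB.instance Definition _ := isMeasurableFun.Build _ _ _ _ pfst (@measurable_fst _ _ T1 T2).
HB.instance Definition _ := isMeasurableFun.Build _ _ _ _ psnd (@measurable_snd _ _ T1 T2).
End projs.

Local Open Scope ereal_scope.

Definition KLdiv d (T : measurableType d) (R : realType)
    (P Q : probability T R) : \bar R :=
  if pselect (P `<< Q) then
    \int[P]_x (ln (fine (Radon_Nikodym (charge_of_finite_measure P) Q x)))%:E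
  else +oo.

Definition mutinf d1 d2 (T1 : measurableType d1) (T2 : measurableType d2)
    (R : realType) (pi : probability (T1 * T2)%type R) : \bar R :=
  KLdiv pi (distribution pi (@pfst _ _ T1 T2) \x distribution pi (@psnd _ _ T1 T2)).

Definition coupling d (T : measurableType d) (R : realType)
    (P Q : probability T R) (gamma : probability (T * T)%type R) : Prop :=
  (forall A, measurable A -> distribution gamma (@pfst _ _ T T) A = P A) /\
  (forall A, measurable A -> distribution gamma (@psnd _ _ T T) A = Q A).

Definition W2sq (R : realType) (L : nat) (P Q : probability (vec R L) R) : \bar R :=
  ereal_inf [set w | exists gamma : probability (vec R L * vec R L)%type R,
     coupling P Q gamma /\ w = \int[gamma]_z (sqdist z.1 z.2)%:E].

Inductive perception := KL_perception | W2_perception.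

Definition phi (R : realType) (L : nat) (m : perception)
    (PX PXh : probability (vec R L) R) : \bar R :=
  match m with
  | KL_perception => KLdiv PXh PX
  | W2_perception => W2sq PX PXh
  end.

Definition gauss1 (R : realType) (mu : set R -> \bar R) (mean var : R) : Prop :=
  forall B, measurable B ->
    mu B = if var == 0%R then \d_mean B else normal_prob mean (Num.sqrt var) B.

Definition gaussian_vec0 (R : realType) (L : nat) (PX : probability (vec R L) R)
    (S : 'M[R]_L) : Prop :=
  forall a : vec R L, gauss1 (pushforward PX (dotv a)) 0 (quadform S a).

Definition joint_gauss0 (R : realType) (L : nat)
    (pi : probability (vec R L * vec R L)%type R) : Prop :=
  forall a b : vec R L, exists v : R, (0 <= v)%R /\
    gauss1 (pushforward pi (fun z => dotv a z.1 + dotv b z.2)%R) 0 v.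

(** Feasible joint laws: first marginal is P_X (i.e. a choice of P_{Xhat|X}),
    distortion and perception constraints hold. *)
Definition feasible (R : realType) (L : nat) (PX : probability (vec R L) R)
    (D P : R) (m : perception) (pi : probability (vec R L * vec R L)%type R) : Prop :=
  (forall A, measurable A -> distribution pi (@pfst _ _ (vec R L) (vec R L)) A = PX A) /\
  \int[pi]_z (sqdist z.1 z.2)%:E <= D%:E /\
  phi m PX (distribution pi (@psnd _ _ (vec R L) (vec R L))) <= P%:E.

Definition RDP (R : realType) (L : nat) (PX : probability (vec R L) R)
    (D P : R) (m : perception) : \bar R :=
  ereal_inf [set i | exists pi, feasible PX D P m pi /\ i = mutinf pi].

Definition RDP_gauss (R : realType) (L : nat) (PX : probability (vec R L) R)
    (D P : R) (m : perception) : \bar R :=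
  ereal_inf [set i | exists pi, (feasible PX D P m pi /\ joint_gauss0 pi)
                                /\ i = mutinf pi].

(* Main.v *)
(** Replace a feasible joint law [pi] by the centred Gaussian law [pi'] with the
    same raw second moments (not the covariances, so that no centring is needed).
    - The distortion is a function of the second moments, so it is unchanged; the
      first marginal is unchanged because it is determined by its one-dimensional
      projections (Cramer-Wold).
    - The information density of [pi'] is a quadratic polynomial [q], hence has
      the same mean under [pi] and [pi'].  Gibbs' variational inequality then gives
      [I(pi) >= E_pi q = E_pi' q = I(pi')].  When the residual covariance of X
      given the reconstruction is singular there is no such density, but then
      [pi] is singular with respect to the product of its marginals and
      [I(pi) = +oo].
    - The same argument on the second marginal shows that the divergence to [PX]
      does not increase; for the Wasserstein distance, replace every coupling by
      the Gaussian one with the same second moments. *)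

Require Import Defs.
From HB Require Import structures.
From mathcomp Require Import all_boot all_order all_algebra.
From mathcomp Require Import all_classical all_reals all_analysis.
From mathcomp Require Import measurable_realfun ring lra.
Set Implicit Arguments. Unset Strict Implicit. Unset Printing Implicit Defensive.
Import Order.TTheory GRing.Theory Num.Theory.
Import numFieldNormedType.Exports.
Local Open Scope classical_set_scope.
Local Open Scope ring_scope.

(** * Standard normal law *)

(** All multivariate analysis is reduced to one standard normal variable. A Gaussian vector is a
    linear image of independent copies; Lebesgue measure on R^n is replaced by [gaussv] reweighted
    by exp(|z|^2/2), and only triangular changes of variables occur, because every covariance is
    factored by Cholesky. Characteristic functions stay real: integrals of cos(a.x + th) with a free
    phase [th] carry both the real and the imaginary part. The matched covariance may be singular.
    The Gaussian law is therefore sampled backwards, Y before X, as X = A Y + F g with A solving the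
    normal equations A E[Y Y^T] = E[X Y^T], whose solvability follows from nonnegativity of second
    moments alone. The information density then compares the conditional law of X given Y with [PX];
    it asks for an invertible F but for no density of Y. The factor [FK] of E[Y Y^T] fixes the law
    of Y and is shared with the couplings of the Wasserstein bound, so that second marginals agree
    exactly. *)

Section bounded_expectation.
Context d (T : measurableType d) (R : realType).
Implicit Types P : probability T R.

Lemma integrable_bounded P (f : T -> R) (C : R) : measurable_fun setT f ->
  (forall x, `|f x| <= C) -> P.-integrable setT (EFin \o f).
Proof.
move=> mf fC; apply: measurable_bounded_integrable => //.
  by apply: le_lt_trans (ltry 1); exact: probability_le1.
exists C; split; first by rewrite num_real.
by move=> M CM x _ /=; rewrite (le_trans (fC x))// ltW.
Qed.

Lemma integral_bounded_fin P (f : T -> R) (C : R) : measurable_fun setT f ->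
  (forall x, `|f x| <= C) -> (\int[P]_x f x)%:E = (\int[P]_x (f x)%:E)%E.
Proof.
by move=> mf fC; rewrite fineK//; apply: integrable_fin_num => //; exact: integrable_bounded fC.
Qed.

Lemma Rintegral_cvg_bounded P (f_ : nat -> T -> R) (f : T -> R) (C : R) :
  (forall n, measurable_fun setT (f_ n)) ->  measurable_fun setT f ->
  (forall n x, `|f_ n x| <= C) -> (forall x, f_ n x @[n --> \oo] --> f x) ->
  (\int[P]_x f_ n x) @[n --> \oo] --> (\int[P]_x f x).
Proof.
move=> mf_ mf fC fcvg.
have [intf _ /=] := @dominated_convergence _ _ _ P setT measurableT
  (fun n => EFin \o f_ n) (EFin \o f) (EFin \o cst C)
  (fun n => (measurable_EFinP _ _).2 (mf_ n)) ((measurable_EFinP _ _).2 mf)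
  ltac:(by apply: aeW => x _ /=; apply: cvg_EFin; [exact: nearW|exact: fcvg])
  ltac:(by apply: (@integrable_bounded _ _ `|C|) => // x /=)
  ltac:(by apply: aeW => x n _ /=; rewrite lee_fin).
move=> h; apply/fine_cvg; rewrite fineK; last by apply: integrable_fin_num.
exact: h.
Qed.

Lemma Rintegral_prob_cst P (r : R) : \int[P]_x r = r.
Proof.
rewrite /Rintegral integral_cst// [X in (_ * X)%E](_ : _ = 1%E) ?mule1//.
exact: probability_setT.
Qed.

End bounded_expectation.

(** * Densities and affine changes of variable on the line *)

Section density.
Context d (T : measurableType d) (R : realType).

(** The Radon-Nikodym derivative of [nu] has the same integral as [g] over every measurable set,
    hence equals [g] almost everywhere. *)
Lemma ge0_integral_density (mu : {sigma_finite_measure set T -> \bar R})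
    (nu : {finite_measure set T -> \bar R}) (g : T -> \bar R) (f : T -> \bar R) :
  measurable_fun setT g -> (forall x, 0 <= g x)%E ->
  (forall A, measurable A -> nu A = \int[mu]_(x in A) g x)%E ->
  measurable_fun setT f -> (forall x, 0 <= f x)%E ->
  (\int[nu]_x f x = \int[mu]_x (f x * g x))%E.
Proof.
move=> mg g0 nug mf f0.
have numu : nu `<< mu.
  apply/null_content_dominatesP => A mA A0; rewrite nug//.
  by apply: null_set_integral => //; exact: measurable_funTS.
rewrite -(Radon_Nikodym_SigmaFinite.change_of_variables numu)//.
apply: ae_eq_integral => //.
- apply: emeasurable_funM => //.
  exact: measurable_int (Radon_Nikodym_SigmaFinite.f_integrable _).
- exact: emeasurable_funM.
apply: ae_eqe_mul2l; apply: integral_ae_eq => //.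
  exact: Radon_Nikodym_SigmaFinite.f_integrable.
by move=> A _ mA; rewrite -Radon_Nikodym_SigmaFinite.f_integral// nug.
Qed.

End density.

Section lebesgue_affine.
Context (R : realType).
Notation mu := (@lebesgue_measure R).
Notation TR := (measurableTypeR R).

(* [lebesgue_measure] and [normal_prob] live on [measurableTypeR R], whose
   display is not convertible to the canonical one of [R]; [toR] moves between
   the two. *)
Definition toR (x : TR) : R := x.

Lemma measurable_toR : measurable_fun setT toR.
Proof. by move=> _ Y mY; rewrite setTI. Qed.

HB.instance Definition _ := isMeasurableFun.Build _ _ _ _ toR measurable_toR.

Lemma measurable_affine (m t : R) : measurable_fun setT (fun x : R => m + t * x).
Proof. by apply: measurable_funD => //; apply: measurable_funM. Qed.

Lemma measurable_affineT (m t : R) : measurable_fun setT (fun x : TR => m + t * x : TR).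
Proof. exact: measurable_affine. Qed.

Definition affineT (m t : R) (x : TR) : TR := m + t * x.

HB.instance Definition _ (m t : R) :=
  isMeasurableFun.Build _ _ _ _ (affineT m t) (measurable_affineT m t).

(** Lebesgue measure is the image of [t] times itself under x -> m + t x: the two agree on half-open
    intervals. *)
Lemma ge0_integral_lebesgue_affine (m t : R) (f : TR -> \bar R) : 0 < t ->
  measurable_fun setT f -> (forall x, 0 <= f x)%E ->
  (\int[mu]_x f x = t%:E * \int[mu]_x f (m + t * x)%R)%E.
Proof.
move=> t0 mf f0.
pose g := affineT m t.
have mg : measurable_fun setT g := measurable_affineT m t.
have tN0 : t != 0 by rewrite gt_eqF.
have mfg : measurable_fun setT (f \o g) by exact: measurableT_comp.
have -> : (t%:E * \int[mu]_x f (m + t * x)%R =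
    \int[mscale (NngNum (ltW t0)) mu]_x (f \o g) x)%E.
  by rewrite (ge0_integral_mscale mu measurableT (NngNum (ltW t0)) mfg (fun x _ => f0 (g x))).
have := ge0_integral_pushforward mg (mscale (NngNum (ltW t0)) mu) measurableT mf (fun x _ => f0 x).
rewrite preimage_setT => <-.
apply: eq_measure_integral => A mA _.
apply: lebesgue_measure_unique => // _ [[a b] _ <-] /=.
rewrite /mscale /=/pushforward/=.
have -> : g @^-1` `]a, b]%classic = `](a - m)/t, (b - m)/t]%classic.
  apply/seteqP; split => x /=; rewrite !in_itv/= /g /affineT;
    by rewrite ltr_pdivrMr// ler_pdivlMr// ltrBlDr lerBrDr (addrC (x * t)) (mulrC x).
rewrite !lebesgue_measure_itv/= !lte_fin ltr_pM2r ?invr_gt0// ltrD2r.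
case: ifP => ab; last by rewrite mule0.
by rewrite -!EFinB -EFinM; congr EFin; field.
Qed.

Definition stdN : probability R R := distribution (normal_prob 0 1) toR.

Lemma ge0_integral_stdN (f : R -> \bar R) :
  measurable_fun setT f -> (forall x, 0 <= f x)%E ->
  (\int[stdN]_x f x = \int[mu]_x (f x * (normal_pdf 0 1 x)%:E))%E.
Proof.
move=> mf f0.
have mf' : measurable_fun setT (f : TR -> \bar R) by exact: mf.
transitivity (\int[normal_prob 0 1]_x (f : TR -> \bar R) x)%E.
  by rewrite (ge0_integral_pushforward measurable_toR _ measurableT mf).
apply: (@ge0_integral_density _ _ _ mu (normal_prob 0 1) _ f) => //.
  by apply/measurable_EFinP; exact: measurable_normal_pdf.
by move=> x; rewrite lee_fin normal_pdf_ge0.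
Qed.

(** Density at [r] of the normal law of mean [m] and standard deviation [s] relative to the standard
    normal law. *)
Definition affine_density (m s r : R) : R :=
  s^-1 * expR (r ^+ 2 / 2 - ((r - m) / s) ^+ 2 / 2).

Lemma affine_density_ge0 (m s r : R) : 0 < s -> 0 <= affine_density m s r.
Proof. by move=> s0; rewrite mulr_ge0 ?expR_ge0// invr_ge0 ltW. Qed.

Lemma measurable_affine_density d (T : measurableType d) (s : R) (m r : T -> R) :
  measurable_fun setT m -> measurable_fun setT r ->
  measurable_fun setT (fun x => affine_density (m x) s (r x)).
Proof.
move=> mm mr.
apply: measurable_funM => //; apply: measurableT_comp => //; apply: measurable_funB.
  by apply: measurable_funM => //; exact: measurable_funX.
apply: measurable_funM => //; apply: measurable_funX; apply: measurable_funM => //.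
exact: measurable_funB.
Qed.

Lemma normal_pdf_affine (m s x : R) : 0 < s ->
  affine_density m s (m + s * x) * normal_pdf 0 1 (m + s * x) * s = normal_pdf 0 1 x.
Proof.
move=> s0; have sN0 : s != 0 by rewrite gt_eqF.
rewrite !normal_pdfE ?oner_eq0// /affine_density /normal_fun.
rewrite [LHS](_ : _ = normal_peak 1 * (expR ((m + s * x) ^+ 2 / 2 - ((m + s * x - m) / s) ^+ 2 / 2) * expR (- (m + s * x - 0) ^+ 2 / (1 ^+ 2 *+ 2)))); last by field.
by rewrite -expRD; congr (_ * expR _); field.
Qed.

(** The exponential shift, the standardisation of [normal_prob], the smoothing of laws and the
    scaling of [lebint] are all instances of this identity. *)
Lemma ge0_stdN_affine (m s : R) (f : R -> \bar R) : 0 < s ->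
  measurable_fun setT f -> (forall x, 0 <= f x)%E ->
  (\int[stdN]_x (f x * (affine_density m s x)%:E) = \int[stdN]_x f (m + s * x)%R)%E.
Proof.
move=> s0 mf f0.
have mfa : measurable_fun setT (fun x => f (m + s * x)).
  by apply: (measurableT_comp mf); exact: measurable_affine.
have mfd : measurable_fun setT (fun x => f x * (affine_density m s x)%:E)%E.
  by apply: emeasurable_funM => //; apply/measurable_EFinP; exact: measurable_affine_density.
have mfdp : measurable_fun setT (fun x : R => f x * (affine_density m s x)%:E * (normal_pdf 0 1 x)%:E)%E.
  by apply: emeasurable_funM => //; apply/measurable_EFinP; exact: measurable_normal_pdf.
have mfdp' : measurable_fun setT (fun x : TR => f x * (affine_density m s x)%:E * (normal_pdf 0 1 x)%:E)%E by exact: mfdp.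
have mfdpa : measurable_fun setT (fun x : TR => f (m + s * x)%R * (affine_density m s (m + s * x)%R)%:E * (normal_pdf 0 1 (m + s * x)%R)%:E)%E.
  by apply: (measurableT_comp mfdp'); exact: measurable_affineT.
have fd0 x : (0 <= f x * (affine_density m s x)%:E)%E.
  by rewrite mule_ge0// lee_fin affine_density_ge0.
have fdp0 x : (0 <= f x * (affine_density m s x)%:E * (normal_pdf 0 1 x)%:E)%E.
  by rewrite mule_ge0// lee_fin normal_pdf_ge0.
rewrite (ge0_integral_stdN mfd fd0) (ge0_integral_stdN mfa (fun x => f0 _)).
rewrite (ge0_integral_lebesgue_affine m s0 mfdp' fdp0).
rewrite -(ge0_integralZl mu measurableT mfdpa (fun x _ => fdp0 _)); last by rewrite lee_fin ltW.
apply: eq_integral => x _.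
by rewrite -(normal_pdf_affine m x s0) !EFinM [LHS]muleC !muleA.
Qed.

Lemma normal_prob_stdN (m s : R) (B : set R) : 0 < s -> measurable B ->
  normal_prob m s B = stdN ((fun u => m + s * u) @^-1` B).
Proof.
move=> s0 mB; have sN0 : s != 0 by rewrite gt_eqF.
have mI : measurable_fun setT (fun x : R => (\1_B x)%:E : \bar R).
  by apply/measurable_EFinP; exact: measurable_indic.
have I0 x : (0 <= (\1_B x)%:E :> \bar R)%E by rewrite lee_fin.
have mad := @measurable_affine_density _ _ s (cst m) idfun (measurable_cst _) (@measurable_id _ _ setT).
transitivity (\int[stdN]_x (\1_B (m + s * x)%R)%:E)%E; last first.
  have mA : measurable ((fun u : R => m + s * u) @^-1` B).
    by rewrite -[X in measurable X]setTI; exact: measurable_affine.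
  by have := @integral_indic _ _ _ stdN setT measurableT _ mA; rewrite setIT.
rewrite -(ge0_stdN_affine m s0 mI I0) ge0_integral_stdN; last 2 first.
- by apply: emeasurable_funM => //; exact/measurable_EFinP.
- by move=> x; rewrite mule_ge0// lee_fin affine_density_ge0.
rewrite /normal_prob integral_mkcond; apply: eq_integral => x _.
rewrite patchE indicE; case: ifPn => _; last by rewrite !mul0e.
rewrite mul1e -EFinM; congr EFin.
rewrite -[in LHS](subrK m x) addrC !normal_pdfE ?oner_eq0// /normal_fun /affine_density/normal_peak.
rewrite -[s ^+ 2 * pi *+ 2]mulrnAr sqrtrM ?sqr_ge0// sqrtr_sqr gtr0_norm//.
rewrite invfM expr1n mul1r [RHS](_ : _ = s^-1 * (Num.sqrt (pi *+ 2))^-1 * (expR (x ^+ 2 / 2 - ((x - m) / s) ^+ 2 / 2) * expR (- (x - 0) ^+ 2 / 2))); last by rewrite mulrACA.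
by rewrite -expRD; congr (_ * expR _); field.
Qed.

End lebesgue_affine.

Section std_normal.
Context (R : realType).
Notation N := (stdN R).
Implicit Types (z t th : R).

(** The one-dimensional Cameron-Martin formula: the exponential tilt is [affine_density t 1]. *)
Lemma ge0_stdN_shift t (f : R -> \bar R) :
  measurable_fun setT f -> (forall x, 0 <= f x)%E ->
  (\int[N]_x (f x * (expR (t * x - t ^+ 2 / 2))%:E) = \int[N]_x f (x + t)%R)%E.
Proof.
move=> mf f0.
transitivity (\int[N]_x (f x * (affine_density t 1 x)%:E))%E.
  apply: eq_integral => x _; rewrite /affine_density invr1 mul1r mulr1; congr (_ * (expR _)%:E)%E.
  by field.
rewrite (ge0_stdN_affine t ltr01 mf f0).
by apply: eq_integral => x _; rewrite mul1r addrC.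
Qed.

Lemma measurable_expR_lin t : measurable_fun setT (fun x : R => expR (t * x)).
Proof. by apply: measurableT_comp => //; exact: measurable_funM. Qed.

Lemma integral_stdN_expR t : (\int[N]_x (expR (t * x))%:E = (expR (t ^+ 2 / 2))%:E)%E.
Proof.
have := @ge0_stdN_shift t (cst (expR (t ^+ 2 / 2))%:E) (measurable_cst _).
rewrite (_ : (\int[N]_x cst _ _)%E = (expR (t ^+ 2 / 2))%:E); last first.
  by rewrite integral_cst// [X in (_ * X)%E](_ : _ = 1%E) ?mule1//; exact: probability_setT.
move=> <-; last by move=> x; rewrite lee_fin expR_ge0.
by apply: eq_integral => x _; rewrite -EFinM -expRD addrC subrK.
Qed.

Lemma integrable_exp2 : N.-integrable setT (fun x => (expR (2 * x) + expR (- 2 * x))%:E).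
Proof.
have m1 t : measurable_fun setT (fun x : R => (expR (t * x))%:E).
  by apply/measurable_EFinP; exact: measurable_expR_lin.
apply/integrableP; split.
  by apply/measurable_EFinP; apply: measurable_funD; exact: measurable_expR_lin.
under eq_integral do rewrite /= ger0_norm ?addr_ge0 ?expR_ge0// EFinD.
rewrite ge0_integralD//; try by move=> x _; rewrite lee_fin expR_ge0.
by rewrite !integral_stdN_expR -EFinD ltry.
Qed.

(** exp(2|x|) is at most exp(2x) + exp(-2x). The exponent 2 leaves room for x^2 and for exp|x| (1 +
    |x|), the two growths met below. *)
Lemma integrable_stdN (f : R -> R) : measurable_fun setT f ->
  (forall x, `|f x| <= expR (2 * `|x|)) -> N.-integrable setT (EFin \o f).
Proof.
move=> mf fb; apply: le_integrable integrable_exp2 => //.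
  exact/measurable_EFinP.
move=> x _; rewrite /= lee_fin (le_trans (fb x))// (le_trans _ (ler_norm _))//.
have [x0|x0] := ler0P x.
  by rewrite mulrN -mulNr lerDr expR_ge0.
by rewrite lerDl expR_ge0.
Qed.

Lemma norm_le_expR2 (x : R) : `|x| <= expR (2 * `|x|).
Proof. have := expR_ge1Dx (2 * `|x|); have := normr_ge0 x; lra. Qed.

Lemma sqr_le_expR2 (x : R) : x ^+ 2 <= expR (2 * `|x|).
Proof.
rewrite -real_normK ?num_real// mulr2n mulrDl mul1r expRD -expr2.
rewrite lerXn2r ?nnegrE ?expR_ge0//.
have := expR_ge1Dx `|x|; lra.
Qed.

End std_normal.

Section bounded_fubini.
Context d1 d2 (T1 : measurableType d1) (T2 : measurableType d2) (R : realType).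
Variables (P : probability T1 R) (Q : probability T2 R).

Lemma Rintegral_swap (f : T1 * T2 -> R) (C : R) : measurable_fun setT f ->
  (forall z, `|f z| <= C) ->
  \int[P]_x \int[Q]_y f (x, y) = \int[Q]_y \int[P]_x f (x, y).
Proof.
move=> mf fC.
have intf : (P \x Q)%E.-integrable setT (EFin \o f) by exact: integrable_bounded fC.
have := Fubini intf; rewrite /Rintegral => /(congr1 fine) h.
transitivity (fine (\int[P]_x (\int[Q]_y (f (x, y))%:E)))%E.
  congr fine; apply: eq_integral => x _; apply: (@integral_bounded_fin _ _ _ Q (fun y => f (x, y)) C) => //.
  exact: measurableT_comp.
rewrite h; congr fine; apply: eq_integral => y _.
apply/esym; apply: (@integral_bounded_fin _ _ _ P (fun x => f (x, y)) C) => //.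
exact: measurableT_comp.
Qed.

Lemma Rintegral_prod (f : T1 * T2 -> R) (C : R) : measurable_fun setT f ->
  (forall z, `|f z| <= C) ->
  \int[(P \x Q)%E]_z f z = \int[P]_x \int[Q]_y f (x, y).
Proof.
move=> mf fC.
have intf : (P \x Q)%E.-integrable setT (EFin \o f) by exact: integrable_bounded fC.
rewrite /Rintegral -(integral12_prod_meas1 intf); congr fine; apply: eq_integral => x _.
apply/esym; apply: (@integral_bounded_fin _ _ _ Q (fun y => f (x, y)) C) => //.
exact: measurableT_comp.
Qed.

End bounded_fubini.

(** * Characteristic function and second moment of the standard normal law *)

Section characteristic_function.
Context (R : realType).
Notation N := (stdN R).
Implicit Types (z t th s : R).

Lemma measurable_sinR : measurable_fun setT (@sin R).
Proof. exact: continuous_measurable_fun (@continuous_sin R). Qed.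

Lemma measurable_cosR : measurable_fun setT (@cos R).
Proof. exact: continuous_measurable_fun (@continuous_cos R). Qed.

Lemma norm_cos_le1 (x : R) : `|cos x| <= 1.
Proof. by rewrite ler_norml cos_geN1 cos_le1. Qed.
Lemma norm_sin_le1 (x : R) : `|sin x| <= 1.
Proof. by rewrite ler_norml sin_geN1 sin_le1. Qed.

(** [ge0_stdN_shift] wants a nonnegative integrand, so it is applied to 1 + f; the constant
    contributes 1 to both sides and cancels. *)
Lemma stdN_shift_bounded t (f : R -> R) : measurable_fun setT f ->
  (forall x, `|f x| <= 1) ->
  \int[N]_s (f s * expR (t * s - t ^+ 2 / 2)) = \int[N]_s f (s + t).
Proof.
move=> mf f1.
have mft : measurable_fun setT (fun s => f (s + t)).
  by apply: (measurableT_comp mf); exact: measurable_funD.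
have me : measurable_fun setT (fun s : R => expR (t * s - t ^+ 2 / 2)).
  by apply: measurableT_comp => //; apply: measurable_funB => //; exact: measurable_funM.
have ie : N.-integrable setT (fun s => (expR (t * s - t ^+ 2 / 2))%:E).
  apply/integrableP; split; first exact/measurable_EFinP.
  have := @ge0_stdN_shift R t (cst 1%E) (measurable_cst _) (fun=> lee01).
  under eq_integral do rewrite mul1e.
  move=> h; under eq_integral do rewrite gee0_abs ?lee_fin ?expR_ge0//.
  rewrite h integral_cst// mul1e.
  by apply: le_lt_trans (ltry 1); exact: probability_le1.
have ife : N.-integrable setT (fun s => (f s * expR (t * s - t ^+ 2 / 2))%:E).
  apply: le_integrable ie => //; first by apply/measurable_EFinP; exact: measurable_funM.
  by move=> s _; rewrite lee_fin normrM ler_piMl.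
have h : (\int[N]_s ((1 + f s) * expR (t * s - t ^+ 2 / 2))%:E = \int[N]_s (1 + f (s + t))%:E)%E.
  have := @ge0_stdN_shift R t (fun s => (1 + f s)%:E).
  apply.
    by apply/measurable_EFinP; exact: measurable_funD.
  by move=> x; rewrite lee_fin; have := f1 x; rewrite ler_norml => /andP[]; lra.
have h1 : (\int[N]_s (expR (t * s - t ^+ 2 / 2))%:E = 1)%E.
  have := @ge0_stdN_shift R t (cst 1%E) (measurable_cst _) (fun=> lee01).
  under eq_integral do rewrite mul1e.
  by move=> ->; rewrite integral_cst// mul1e; exact: probability_setT.
move/(congr1 fine): h.
under eq_integral do rewrite mulrDl mul1r.
rewrite -[LHS]/(\int[N]_s (expR (t * s - t ^+ 2 / 2) + f s * expR (t * s - t ^+ 2 / 2))).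
rewrite -[RHS]/(\int[N]_s (1 + f (s + t))).
have i1 : N.-integrable setT (EFin \o (fun=> 1 : R)).
  by apply: (@integrable_bounded _ _ _ N (fun=> 1) 1) => // x; rewrite normr1.
have i2 : N.-integrable setT (EFin \o (fun s => f (s + t))).
  by apply: (@integrable_bounded _ _ _ N _ 1).
rewrite (RintegralD measurableT ie ife) (RintegralD measurableT i1 i2).
rewrite Rintegral_prob_cst.
by rewrite /Rintegral h1/= => /addrI.
Qed.

Lemma is_derive_lin (a b x : R) : is_derive x 1 (fun t : R => t * a + b) a.
Proof.
by apply: is_derive_eq; rewrite /GRing.scale/=; ring.
Qed.

Lemma is_derive_cos_lin (a b x : R) : is_derive x 1 (fun t => cos (t * a + b)) (- sin (x * a + b) * a).
Proof.
exact: (@is_derive1_comp _ cos (fun t => t * a + b) x _ _ (is_derive_cos _) (is_derive_lin a b x)).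
Qed.

Lemma is_derive_sin_lin (a b x : R) : is_derive x 1 (fun t => sin (t * a + b)) (cos (x * a + b) * a).
Proof.
exact: (@is_derive1_comp _ sin (fun t => t * a + b) x _ _ (is_derive_sin _) (is_derive_lin a b x)).
Qed.

Lemma measurable_cos_lin z th : measurable_fun setT (fun s : R => cos (z * s + th)).
Proof. by apply: (measurableT_comp measurable_cosR); apply: measurable_funD => //; apply: measurable_funM. Qed.

Lemma measurable_sin_lin z th : measurable_fun setT (fun s : R => sin (z * s + th)).
Proof. by apply: (measurableT_comp measurable_sinR); apply: measurable_funD => //; apply: measurable_funM. Qed.

Lemma integrable_stdN_exp : N.-integrable setT (EFin \o (fun s : R => expR (2 * `|s|))).
Proof.
apply: integrable_stdN.
  by apply: measurableT_comp => //; apply: measurable_funM => //; exact: measurableT_comp.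
by move=> x; rewrite ger0_norm ?expR_ge0.
Qed.

(* Both sides are the derivative at t = 0 of E[sin (z (s + t) + th)]. *)
Lemma stdN_ibp z th :
  \int[N]_s (s * sin (z * s + th)) = z * \int[N]_s cos (z * s + th).
Proof.
pose F1 t s : R := sin (z * s + th) * expR (t * s - t ^+ 2 / 2).
pose F2 t s : R := sin (t * z + (z * s + th)).
have mF1 t : measurable_fun setT (F1 t).
  apply: measurable_funM; first exact: measurable_sin_lin.
  by apply: measurableT_comp => //; apply: measurable_funB => //; exact: measurable_funM.
have eF t : \int[N]_s F1 t s = \int[N]_s F2 t s.
  rewrite (@stdN_shift_bounded t (fun s => sin (z * s + th))).
  - by apply: eq_Rintegral => s _; rewrite /F2; congr sin; ring.
  - exact: measurable_sin_lin.
  - by move=> x; exact: norm_sin_le1.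
have d1 t s : is_derive t 1 (F1 ^~ s) (sin (z * s + th) * (expR (t * s - t ^+ 2 / 2) * (s - t))).
  by apply: is_derive_eq; rewrite /GRing.scale/=; field.
have d2 t s : is_derive t 1 (F2 ^~ s) (cos (t * z + (z * s + th)) * z).
  exact: is_derive_sin_lin.
have I0 : `](-1), 1[%classic (0 : R) by rewrite /= in_itv/= ltr01 ltrN10.
have expb t s : -1 < t < 1 -> expR (t * s - t ^+ 2 / 2) <= expR `|s|.
  move=> /andP[t1 t2]; rewrite ler_expR.
  have ts : t * s <= `|s|.
    rewrite (le_trans (ler_norm _))// normrM ler_piMl//.
    by rewrite ler_norml !ltW.
  by have := sqr_ge0 t; lra.
have c1 := @cvg_differentiation_under_integral R _ _ N F1 setT measurableT 0 (-1) 1 I0.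
have c2 := @cvg_differentiation_under_integral R _ _ N F2 setT measurableT 0 (-1) 1 I0.
have {}c1 : h^-1 *: (\int[N]_s F1 (h + 0) s - \int[N]_s F1 0 s) @[h --> 0^'] --> \int[N]_s (s * sin (z * s + th)).
  rewrite (_ : \int[N]_s (s * sin (z * s + th)) = \int[N]_(s in setT) partial1of2 F1 0 s); last first.
    apply: eq_Rintegral => s _; rewrite partial1of2E (@derive_val _ _ _ _ _ _ _ (d1 0 s)).
    by rewrite mul0r expr0n/= mul0r subr0 expR0 mul1r subr0 mulrC.
  (* For |t| < 1 the tilt is at most exp|s|, and the factor s - t is at most 1 + |s|, hence at most
     exp|s| as well. *)
  apply: (c1 _ _ (fun s => expR (2 * `|s|))) => //.
  - move=> t; rewrite /= in_itv/= => tI; apply: integrable_stdN => // s.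
    rewrite normrM (ger0_norm (expR_ge0 _)) (le_trans (ler_piMl (expR_ge0 _) (norm_sin_le1 _)))//.
    rewrite (le_trans (expb _ _ tI))// ler_expR ler_peMl// ler1n//.
  - exact: integrable_stdN_exp.
  - move=> t s; rewrite /= in_itv/= => tI _; rewrite partial1of2E (@derive_val _ _ _ _ _ _ _ (d1 t s)).
    rewrite normrM (le_trans (ler_piMl (normr_ge0 _) (norm_sin_le1 _)))//.
    rewrite normrM ger0_norm ?expR_ge0//.
    have -> : expR (2 * `|s|) = expR `|s| * expR `|s| by rewrite -expRD; congr expR; ring.
    rewrite ler_pM ?expR_ge0//.
      exact: expb.
    rewrite (le_trans (ler_normB _ _))//.
    have := expR_ge1Dx `|s|.
    have : `|t| <= 1 by rewrite ler_norml; case/andP: tI => *; rewrite !ltW.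
    lra.
have {}c2 : h^-1 *: (\int[N]_s F2 (h + 0) s - \int[N]_s F2 0 s) @[h --> 0^'] --> z * \int[N]_s cos (z * s + th).
  rewrite (_ : z * _ = \int[N]_(s in setT) partial1of2 F2 0 s); last first.
    rewrite -RintegralZl//; last by apply: (@integrable_bounded _ _ _ _ _ 1); [exact: measurable_cos_lin|move=> x; exact: norm_cos_le1].
    apply: eq_Rintegral => s _; rewrite partial1of2E (@derive_val _ _ _ _ _ _ _ (d2 0 s)).
    by rewrite mul0r add0r mulrC.
  apply: (c2 _ _ (fun s => `|z|)) => //.
  - move=> t _; apply: (@integrable_bounded _ _ _ _ _ 1); last by move=> x; exact: norm_sin_le1.
    rewrite /F2; under eq_fun do rewrite addrCA. exact: measurable_sin_lin.
  - by apply: (@integrable_bounded _ _ _ _ (cst `|z|) `|z|) => // x; rewrite /= normr_id.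
  - move=> t s _ _; rewrite partial1of2E (@derive_val _ _ _ _ _ _ _ (d2 t s)).
    by rewrite normrM ler_piMl// norm_cos_le1.
apply: (cvg_unique _ c1) => //=.
by under eq_fun do rewrite !eF.
Qed.

(** As a function of z, the left side u satisfies u' = - z u by [stdN_ibp], so u(z) exp(z^2/2) is
    constant; its value is read at z = 0. *)
Lemma stdN_cos z th : \int[N]_s cos (z * s + th) = cos th * expR (- (z ^+ 2 / 2)).
Proof.
pose u z := \int[N]_s cos (z * s + th).
have du (x : R) : is_derive x (1 : R) u (- (x * u x)).
  have d1 t s : is_derive t 1 (fun t => cos (t * s + th)) (- sin (t * s + th) * s).
    exact: is_derive_cos_lin.
  have xI : `]x - 1, x + 1[%classic x.
    by rewrite /= in_itv/=; apply/andP; split; lra.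
  have mc t : measurable_fun setT (fun s : R => cos (t * s + th)) by exact: measurable_cos_lin.
  have ic t : N.-integrable setT (EFin \o (fun s => cos (t * s + th))).
    by apply: (@integrable_bounded _ _ _ _ _ 1) => // s; exact: norm_cos_le1.
  have iabs : N.-integrable setT (EFin \o (fun s : R => `|s|)).
    apply: integrable_stdN; first exact: measurableT_comp.
    by move=> s; rewrite normr_id norm_le_expR2.
  have bd t s : `|partial1of2 (fun t s => cos (t * s + th)) t s| <= `|s|.
    rewrite partial1of2E (@derive_val _ _ _ _ _ _ _ (d1 t s)) normrM normrN.
    by rewrite ler_piMl// norm_sin_le1.
  have dru := @derivable_under_integral R _ _ N (fun t s => cos (t * s + th)) setT measurableT x (x - 1) (x + 1) xI
     (fun t _ => ic t) (fun t s _ _ => @ex_derive _ _ _ _ _ _ _ (d1 t s)) (fun s => `|s|) (fun s => normr_ge0 s) iabs (fun t s _ _ => bd t s).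
  have dvu := @differentiation_under_integral R _ _ N (fun t s => cos (t * s + th)) setT measurableT x (x - 1) (x + 1) xI
     (fun t _ => ic t) (fun t s _ _ => @ex_derive _ _ _ _ _ _ _ (d1 t s)) (fun s => `|s|) (fun s => normr_ge0 s) iabs (fun t s _ _ => bd t s).
  apply: DeriveDef => //.
  rewrite -derive1E dvu -stdN_ibp -mulN1r -RintegralZl//; last first.
    apply: integrable_stdN; first by apply: measurable_funM => //; exact: measurable_sin_lin.
    by move=> s; rewrite normrM (le_trans (ler_piMr (normr_ge0 _) (norm_sin_le1 _)))// norm_le_expR2.
  apply: eq_Rintegral => s _; rewrite partial1of2E (@derive_val _ _ _ _ _ _ _ (d1 x s)).
  by rewrite mulN1r mulNr mulrC.
have dv (x : R) : is_derive x (1 : R) (fun x => u x * expR (x ^+ 2 / 2)) 0.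
  have de : is_derive x 1 (fun x : R => expR (x ^+ 2 / 2)) (expR (x ^+ 2 / 2) * x).
    apply: (@is_derive1_comp _ expR (fun t => t ^+ 2 / 2) x _ _ (is_derive_expR _)).
    by apply: is_derive_eq; rewrite /GRing.scale/=; field.
  by apply: is_derive_eq; rewrite /GRing.scale/=; field.
have := is_derive_0_is_cst z 0 dv.
rewrite expr0n/= mul0r expR0 mulr1 => h.
have -> : \int[N]_s cos (z * s + th) = u z * expR (z ^+ 2 / 2) * expR (- (z ^+ 2 / 2)).
  by rewrite -mulrA -expRD subrr expR0 mulr1.
rewrite h; congr (_ * _).
rewrite /u (@eq_Rintegral _ _ _ _ _ (cst (cos th))); last by move=> s _; rewrite mul0r add0r.
exact: Rintegral_prob_cst.
Qed.

(** With N = n + 1, [stdN_ibp] at z = 1/N gives E[s N sin(s/N)] = exp(-1/(2 N^2)). The right side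
    tends to 1, and the integrand tends to s^2 while staying below s^2 in absolute value. *)
Lemma stdN_sqr : (\int[N]_s (s ^+ 2)%:E = 1)%E.
Proof.
have isq : N.-integrable setT (EFin \o (fun s : R => s ^+ 2)).
  apply: integrable_stdN; first exact: measurable_funX.
  by move=> s; rewrite ger0_norm ?sqr_ge0// sqr_le_expR2.
have h n : \int[N]_s (s * (n.+1%:R * sin (n.+1%:R^-1 * s + 0))) = expR (- (n.+1%:R^-1 ^+ 2 / 2)).
  have := stdN_ibp n.+1%:R^-1 0; rewrite stdN_cos cos0 mul1r.
  move/(congr1 (fun x => n.+1%:R * x)); rewrite mulVKf ?pnatr_eq0// => <-.
  rewrite -RintegralZl//; last first.
    apply: integrable_stdN; first by apply: measurable_funM => //; exact: measurable_sin_lin.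
    by move=> s; rewrite normrM (le_trans (ler_piMr (normr_ge0 _) (norm_sin_le1 _)))// norm_le_expR2.
  by apply: eq_Rintegral => s _; rewrite mulrCA.
have sinb (x : R) : `|sin x| <= `|x|.
  wlog x0 : x / 0 < x.
    move=> hw; have [x0|x0|->] := ltgtP x 0; [|exact: hw|by rewrite sin0].
    by rewrite -normrN -sinN -[leRHS]normrN hw// oppr_gt0.
  have csin : {within `[0, x], continuous (@sin R)}.
    by apply: continuous_subspaceT => y; exact: continuous_sin.
  have [c _ ] := @MVT R sin cos 0 x x0 (fun y _ => is_derive_sin y) csin.
  by rewrite sin0 !subr0 => ->; rewrite normrM ler_piMl// norm_cos_le1.
have cvs (s : R) : n.+1%:R * sin (n.+1%:R^-1 * s + 0) @[n --> \oo] --> s.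
  have [->|s0] := eqVneq s 0.
    by under eq_fun do rewrite mulr0 addr0 sin0 mulr0; exact: cvg_cst.
  have := @is_derive_sin R 0; rewrite cos0 => ds.
  have : (fun h : R => h^-1 *: (sin (h + 0) - sin 0)) @ 0^' --> (1 : R).
    have /cvg_ex[l lP] := @ex_derive _ _ _ _ _ _ _ ds.
    have := @derive_val _ _ _ _ _ _ _ ds; rewrite /derive => e.
    have lE : l = 1 by rewrite -e; apply/esym/cvg_lim => //.
    by rewrite -lE; move: lP; under eq_fun do rewrite scaler1.
  move=> /cvgr_dnbhsP /(_ (fun n => n.+1%:R^-1 * s)).
  have hh : (forall n : nat, n.+1%:R^-1 * s != 0) /\ (fun n : nat => n.+1%:R^-1 * s) @ \oo --> 0.
    split; first by move=> n; rewrite mulf_neq0// invr_eq0 pnatr_eq0.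
    rewrite -(mul0r s); apply: cvgM; last exact: cvg_cst.
    exact: cvg_harmonic.
  move=> /(_ hh) /(cvgM (cvg_cst s)).
  rewrite mulr1; apply: cvg_trans; apply: near_eq_cvg; apply: nearW => n /=.
  rewrite sin0 subr0 /GRing.scale/= invfM invrK.
  by rewrite mulrA (mulrCA s) divff// mulr1.
have msn n : measurable_fun setT (fun s : R => s * (n.+1%:R * sin (n.+1%:R^-1 * s + 0))).
  by apply: measurable_funM => //; apply: measurable_funM => //; exact: measurable_sin_lin.
have [_ _ /=] := @dominated_convergence _ _ _ N setT measurableT
  (fun n s => (s * (n.+1%:R * sin (n.+1%:R^-1 * s + 0)))%:E) (fun s => (s ^+ 2)%:E) (fun s => (s ^+ 2)%:E)
  (fun n => (measurable_EFinP _ _).2 (msn n)) ((measurable_EFinP _ _).2 (measurable_funX _ (@measurable_id _ _ setT)))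
  ltac:(by apply: aeW => s _ /=; apply: cvg_EFin; [exact: nearW|rewrite expr2; apply: cvgM; [exact: cvg_cst|exact: cvs]])
  isq
  ltac:(by apply: aeW => s n _ /=; rewrite lee_fin normrM -[leRHS]real_normK ?num_real// expr2 ler_wpM2l//
    normrM (le_trans (ler_wpM2l (normr_ge0 _) (sinb _)))// addr0 -normrM mulVKf ?pnatr_eq0).
have -> : (fun n => \int[N]_s (s * (n.+1%:R * sin (n.+1%:R^-1 * s + 0)))%:E)%E =
    (fun n => (expR (- (n.+1%:R^-1 ^+ 2 / 2)))%:E).
  apply/funext => n; rewrite -h fineK//; apply: integrable_fin_num => //.
  apply: integrable_stdN => // s.
  rewrite normrM (le_trans _ (sqr_le_expR2 s))// -[leRHS]real_normK ?num_real// expr2 ler_wpM2l//.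
  by rewrite normrM (le_trans (ler_wpM2l (normr_ge0 _) (sinb _)))// addr0 -normrM mulVKf ?pnatr_eq0.
move=> c1; apply: (cvg_unique _ c1) => //.
apply: cvg_EFin; first exact: nearW.
have c0 : (fun n : nat => - (n.+1%:R^-1 * n.+1%:R^-1 / 2) : R) @ \oo --> (- (0 * 0 / 2) : R).
  apply: cvgN; apply: cvgM; last exact: cvg_cst.
  by apply: cvgM; exact: cvg_harmonic.
rewrite mul0r mul0r oppr0 in c0.
rewrite -[X in _ --> X]expR0; under eq_fun do rewrite expr2.
exact: (cvg_comp _ _ c0 (@continuous_expR R 0)).
Qed.

End characteristic_function.

(** * Uniqueness of characteristic functions *)

Section ray_determination.
Context d (T : measurableType d) (R : realType).
(** [s] will be one coordinate and [w] a weight carrying the remaining information; the bound 2 is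
    that of 1 + cos. *)
Variables (w s : T -> R).
Hypothesis (mw : measurable_fun setT w) (w0 : forall x, 0 <= w x) (w2 : forall x, w x <= 2).
Hypothesis ms : measurable_fun setT s.
Notation N := (stdN R).

Let wnorm2 x : `|w x| <= 2. Proof. by rewrite ger0_norm. Qed.

(** The factor exp(-((r - m)/e)^2/2) is itself the characteristic function of [stdN] at (m -
    r)/e. *)
Lemma affine_density_cos (m e r : R) : 0 < e ->
  affine_density m e r =
  e^-1 * expR (r ^+ 2 / 2) * \int[N]_v cos (v / e * m - v / e * r).
Proof.
move=> e0; rewrite /affine_density expRD -mulrA; congr (_ * (_ * _)).
rewrite (@eq_Rintegral _ _ _ _ _ (fun v => cos ((m - r) / e * v + 0))); last first.
  by move=> v _; congr cos; ring.
rewrite stdN_cos cos0 mul1r; congr (expR (- (_ / 2))).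
by rewrite -sqrrN -mulNr opprB.
Qed.

(* Convolving with a normal law of standard deviation [e] turns the weighted law
   of [s] into an average of its trigonometric moments. *)
Lemma smoothed_weight (P : probability T R) (e r : R) : 0 < e ->
  \int[P]_x (w x * affine_density (s x) e r) =
  e^-1 * expR (r ^+ 2 / 2) *
    \int[N]_v \int[P]_x (w x * cos (v / e * s x + - (v / e * r))).
Proof.
move=> e0.
have mg : measurable_fun setT (fun z : T * R => w z.1 * cos (z.2 / e * s z.1 - z.2 / e * r)).
  have m1 : measurable_fun setT (fun z : T * R => z.2 / e) by exact: measurable_funM.
  apply: measurable_funM; first exact: measurableT_comp.
  apply: (measurableT_comp (@measurable_cosR R)); apply: measurable_funB.
    by apply: measurable_funM => //; exact: measurableT_comp.
  exact: measurable_funM.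
have gb (z : T * R) : `|w z.1 * cos (z.2 / e * s z.1 - z.2 / e * r)| <= 2.
  by rewrite normrM (le_trans (ler_piMr (normr_ge0 _) (norm_cos_le1 _)))// wnorm2.
rewrite -(@Rintegral_swap _ _ _ _ _ P N _ 2 mg gb)/=.
have mgx x : measurable_fun setT (fun v : R => cos (v / e * s x - v / e * r)).
  apply: (measurableT_comp (@measurable_cosR R)).
  by apply: measurable_funB; apply: measurable_funM => //; exact: measurable_funM.
have ix x : N.-integrable setT (EFin \o (fun v => cos (v / e * s x - v / e * r))).
  by apply: (@integrable_bounded _ _ _ N _ 1) => // v; exact: norm_cos_le1.
have K0 : e^-1 * expR (r ^+ 2 / 2) != 0 by rewrite mulf_neq0 ?gt_eqF ?expR_gt0 ?invr_gt0.
have eqx x : w x * affine_density (s x) e r =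
    e^-1 * expR (r ^+ 2 / 2) * \int[N]_v (w x * cos (v / e * s x - v / e * r)).
  by rewrite (affine_density_cos _ _ e0) (RintegralZl _ measurableT (ix x)); ring.
rewrite -RintegralZl//; first by apply: eq_Rintegral => x _; exact: eqx.
(* Measurability of the inner integral in [x] is read off its closed form. *)
have -> : (fun x => \int[N]_v (w x * cos (v / e * s x - v / e * r))) =
   (fun x => (e^-1 * expR (r ^+ 2 / 2))^-1 * (w x * affine_density (s x) e r)).
  by apply/funext => x; rewrite eqx mulKf.
apply: (@integrable_bounded _ _ _ P _ 2).
  apply: measurable_funM => //; apply: measurable_funM => //.
  exact: measurable_affine_density.
move=> x; rewrite eqx mulKf// (RintegralZl _ measurableT (ix x)) normrM.
rewrite (le_trans _ (wnorm2 x))// ler_piMr//.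
rewrite (le_trans (le_normr_Rintegral measurableT (ix x)))//.
rewrite -[leRHS](Rintegral_prob_cst N 1); apply: le_Rintegral => //.
- apply: (@integrable_bounded _ _ _ N _ 1); first exact: measurableT_comp.
  by move=> v; rewrite normr_id norm_cos_le1.
- by apply: (@integrable_bounded _ _ _ N (fun=> 1) 1) => // v; rewrite normr1.
- by move=> v _; exact: norm_cos_le1.
Qed.

(** Integrating the smoothed density over r <= c produces the normal distribution function at (c - s
    x)/e. By [smoothed_weight] the density depends on the law only through trigonometric moments. *)
Lemma smoothed_ray (P1 P2 : probability T R) (e c : R) : 0 < e ->
  (forall z th, \int[P1]_x (w x * cos (z * s x + th)) = \int[P2]_x (w x * cos (z * s x + th))) ->
  \int[P1]_x (w x * fine (N `]-oo, (c - s x) / e]%classic)) = \int[P2]_x (w x * fine (N `]-oo, (c - s x) / e]%classic)).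
Proof.
move=> e0 charE.
have mI : measurable_fun setT (fun r : R => (\1_`]-oo, c] r)%:E : \bar R).
  by apply/measurable_EFinP; exact: measurable_indic.
have key (P : probability T R) : \int[P]_x (w x * fine (N `]-oo, (c - s x) / e]%classic)) =
    fine (\int[N]_r ((\1_`]-oo, c] r)%:E * (\int[P]_x (w x * affine_density (s x) e r))%:E))%E.
  rewrite /Rintegral; congr fine.
  transitivity (\int[P]_x \int[N]_r ((w x)%:E * ((\1_`]-oo, c] r)%:E * (affine_density (s x) e r)%:E)))%E.
    apply: eq_integral => x _.
    rewrite ge0_integralZl//; last 3 first.
    - apply: emeasurable_funM => //; apply/measurable_EFinP.
      exact: measurable_affine_density.
    - by move=> r _; rewrite mule_ge0// lee_fin affine_density_ge0.
    - by rewrite lee_fin.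
    rewrite EFinM fineK; last by rewrite fin_num_measure.
    congr (_ * _)%E.
    rewrite (@ge0_stdN_affine R (s x) e _ e0 mI); last by move=> r; rewrite lee_fin.
    have mA : measurable (`]-oo, (c - s x) / e]%classic : set R) by [].
    have := @integral_indic _ _ _ N setT measurableT _ mA; rewrite setIT => <-.
    apply: eq_integral => r _; rewrite !indicE; congr ((nat_of_bool _)%:R%:E).
    apply/idP/idP; rewrite !inE/= !in_itv/= ler_pdivlMr// lerBrDl (mulrC r)//.
  have mh : measurable_fun setT (fun z : T * R => ((w z.1)%:E * ((\1_`]-oo, c] z.2)%:E * (affine_density (s z.1) e z.2)%:E))%E).
    apply: emeasurable_funM; first by apply/measurable_EFinP; exact: measurableT_comp.
    apply: emeasurable_funM; first exact: (measurableT_comp mI).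
    apply/measurable_EFinP; apply: measurable_affine_density => //.
    exact: measurableT_comp.
  rewrite (@fubini_tonelli _ _ _ _ _ P N _ mh); last first.
    by move=> z; rewrite !mule_ge0// lee_fin// affine_density_ge0.
  apply: eq_integral => r _ /=.
  have mwa : measurable_fun setT (fun x => w x * affine_density (s x) e r).
    by apply: measurable_funM => //; exact: measurable_affine_density.
  rewrite (@integral_bounded_fin _ _ _ P _ (2 * (e^-1 * expR (r ^+ 2 / 2))) mwa); last first.
    move=> x; rewrite normrM ler_pM// ger0_norm ?affine_density_ge0//.
    rewrite /affine_density ler_pM2l ?invr_gt0// ler_expR gerBl.
    by rewrite mulr_ge0 ?sqr_ge0// invr_ge0.
  rewrite -ge0_integralZl//; last 2 first.
  - exact/measurable_EFinP.
  - by move=> x _; rewrite lee_fin mulr_ge0 ?affine_density_ge0.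
  by apply: eq_integral => x _; rewrite muleCA EFinM.
rewrite !key; congr fine; apply: eq_integral => r _; congr (_ * _%:E)%E.
rewrite !smoothed_weight//; congr (_ * _); apply: eq_Rintegral => v _; exact: charE.
Qed.

Let ncdf (r : R) : R := fine (N `]-oo, r]%classic).

Let X : {RV (normal_prob 0 1 : probability (measurableTypeR R) R) >-> R} := @toR R.

Let measurable_ncdf : measurable_fun setT ncdf.
Proof.
exact: (measurableT_comp (@fine_measurable R _ measurableT) (cdf_measurable X)).
Qed.

Let ncdf_bound r : `|ncdf r| <= 1.
Proof.
rewrite ger0_norm ?fine_ge0//.
by rewrite -[leRHS]/(fine (1%E : \bar R)) fine_le ?fin_num_measure// probability_le1.
Qed.

(* Smoothing scale [1/n^2] and shift [1/n]: the shift makes the limit equal to 1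
   at the endpoint [b] too. *)
Lemma ray_cvg (b t : R) :
  ncdf ((b - t) * n.+1%:R ^+ 2 + n.+1%:R) @[n --> \oo] --> (\1_`]-oo, b] t : R).
Proof.
have n1 : (fun n : nat => n.+1%:R : R) @ \oo --> +oo.
  by rewrite (cvg_shiftS (fun n => n%:R : R)); exact: cvgr_idn.
rewrite indicE; have [tb|tb] := leP t b.
  rewrite mem_set/=; last by rewrite in_itv.
  have c1 : fine (cdf X r) @[r --> +oo] --> (1 : R) by apply/fine_cvg; exact: cvg_cdfy1.
  apply: (cvg_comp _ _ _ c1).
  apply: (ger_cvgy _ n1); apply: nearW => n.
  by rewrite lerDr mulr_ge0 ?subr_ge0// sqr_ge0.
rewrite memNset/=; last by rewrite in_itv/= leNgt tb.
have c1 : fine (cdf X r) @[r --> -oo] --> (0 : R) by apply/fine_cvg; exact: cvg_cdfNy0.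
apply: (cvg_comp _ _ _ c1).
have n2 : (fun n : nat => - n.+1%:R : R) @ \oo --> -oo by apply/cvgrNyPle => A; have /cvgryPge/(_ (- A)) := n1; apply: filterS => n; rewrite lerNl.
apply: (ler_cvgNy _ n2).
have bt0 : 0 < t - b by rewrite subr_gt0.
have /cvgryPge /(_ (2 / (t - b))) := n1; apply: filterS => n.
rewrite ler_pdivrMr// => hn.
have n0 : 0 < n.+1%:R :> R by rewrite ltr0n.
have -> : (b - t) * n.+1%:R ^+ 2 = - (n.+1%:R * (t - b) * n.+1%:R) by ring.
have : 2 * n.+1%:R <= n.+1%:R * (t - b) * n.+1%:R by rewrite ler_pM2r.
by move: (n.+1%:R * (t - b) * n.+1%:R) => q; lra.
Qed.

(** Limit of [smoothed_ray] with N = n + 1, e = 1/N^2 and c = b + 1/N, for which (c - s x)/e is the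
    argument (b - s x) N^2 + N of [ray_cvg]. *)
Lemma ray_determined (P1 P2 : probability T R) (b : R) :
  (forall z th, \int[P1]_x (w x * cos (z * s x + th)) = \int[P2]_x (w x * cos (z * s x + th))) ->
  \int[P1]_x (w x * \1_`]-oo, b] (s x)) = \int[P2]_x (w x * \1_`]-oo, b] (s x)).
Proof.
move=> charE.
pose f n x := w x * ncdf ((b - s x) * n.+1%:R ^+ 2 + n.+1%:R).
have fE (P : probability T R) : \int[P]_x f n x @[n --> \oo] --> \int[P]_x (w x * \1_`]-oo, b] (s x)).
  apply: (@Rintegral_cvg_bounded _ _ _ P _ _ 2).
  - move=> n; apply: measurable_funM => //; apply: (measurableT_comp measurable_ncdf).
    by apply: measurable_funD => //; apply: measurable_funM => //; exact: measurable_funB.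
  - by apply: measurable_funM => //; apply: (measurableT_comp _ ms); exact: measurable_indic.
  - move=> n x; rewrite normrM (le_trans (ler_piMr (normr_ge0 _) (ncdf_bound _)))//.
  - by move=> x; apply: cvgM; [exact: cvg_cst|exact: ray_cvg].
apply: (cvg_unique _ (fE P1)) => //=.
suff -> : (fun n => \int[P1]_x f n x) = (fun n => \int[P2]_x f n x) by exact: fE.
apply/funext => n; have n0 : 0 < n.+1%:R :> R by rewrite ltr0n.
have e0 : 0 < (n.+1%:R ^+ 2)^-1 :> R by rewrite invr_gt0 exprn_gt0.
have h (P : probability T R) : \int[P]_x f n x =
   \int[P]_x (w x * fine (N `]-oo, (b + n.+1%:R^-1 - s x) / (n.+1%:R ^+ 2)^-1]%classic)).
  apply: eq_Rintegral => x _; congr (_ * ncdf _).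
  by rewrite invrK; field; rewrite nat1r gt_eqF.
by rewrite !h; exact: smoothed_ray.
Qed.

End ray_determination.

Section vector_operations.
Context {R : realType} {n : nat}.
Implicit Types (a b x : vec R n) (c z : R).

Definition vadd a b : vec R n := [tuple tnth a i + tnth b i | i < n].
Definition scalev c a : vec R n := [tuple c * tnth a i | i < n].
Definition unitv (k : 'I_n) : vec R n := [tuple (i == k)%:R | i < n].
Definition zerov : vec R n := [tuple 0 | i < n].

Lemma dotvDl a b x : dotv (vadd a b) x = dotv a x + dotv b x.
Proof.
by rewrite /dotv -big_split; apply: eq_bigr => i _; rewrite tnth_mktuple mulrDl.
Qed.

Lemma dotvZl c a x : dotv (scalev c a) x = c * dotv a x.
Proof.
by rewrite /dotv mulr_sumr; apply: eq_bigr => i _; rewrite tnth_mktuple mulrA.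
Qed.

Lemma dotvC a x : dotv a x = dotv x a.
Proof. by apply: eq_bigr => i _; rewrite mulrC. Qed.

Lemma dotv_unit k x : dotv (unitv k) x = tnth x k.
Proof.
rewrite /dotv (bigD1 k)//= tnth_mktuple eqxx mul1r big1 ?addr0// => i ik.
by rewrite tnth_mktuple (negbTE ik) mul0r.
Qed.

Lemma dotv0l x : dotv zerov x = 0.
Proof. by rewrite /dotv big1// => i _; rewrite tnth_mktuple mul0r. Qed.

Lemma measurable_tnthR (k : 'I_n) : measurable_fun setT (fun x : vec R n => tnth x k).
Proof. exact: measurable_tnth. Qed.

Lemma measurable_dotv d (T : measurableType d) (f g : T -> vec R n) :
  measurable_fun setT f -> measurable_fun setT g ->
  measurable_fun setT (fun x : T => dotv (f x) (g x)).
Proof.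
move=> mf mg; rewrite /dotv; apply: measurable_sum => i.
by apply: measurable_funM; apply: (measurableT_comp (measurable_tnthR i)).
Qed.

Lemma measurable_dotvr a : measurable_fun setT (dotv a).
Proof. exact: measurable_dotv. Qed.

End vector_operations.

(** * The Cramér-Wold theorem *)

Section cramer_wold.
Context (R : realType) (n : nat).
Notation V := (vec R n).
Variables (P1 P2 : probability V R).
Hypothesis charE : forall (a : V) th,
  \int[P1]_x cos (dotv a x + th) = \int[P2]_x cos (dotv a x + th).

Let ray (b : R) (r : R) : R := \1_`]-oo, b] r.

(** Only the first [k] coordinates are constrained: k = 0 is the hypothesis on trigonometric
    moments, k = n the indicator of an orthant. *)
Let box (b : 'I_n -> R) (k : nat) (x : V) : R :=
  \prod_(i < n | (i < k)%N) ray (b i) (tnth x i).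

Let ray01 b r : 0 <= ray b r <= 1.
Proof. by rewrite /ray indicE ler0n lern1 leq_b1. Qed.

Let box01 b k x : 0 <= box b k x <= 1.
Proof.
apply/andP; split; first by apply: prodr_ge0 => i _; case/andP: (ray01 (b i) (tnth x i)).
by apply: prodr_ile1 => i _; exact: ray01.
Qed.

Let measurable_ray b (k : 'I_n) : measurable_fun setT (fun x : V => ray b (tnth x k)).
Proof. by apply: (measurableT_comp _ (measurable_tnthR k)); exact: measurable_indic. Qed.

Let measurable_box b k : measurable_fun setT (box b k).
Proof.
rewrite (_ : box b k = fun x => \prod_(i < n) (if (i < k)%N then ray (b i) (tnth x i) else 1)); last first.
  by apply/funext => x; rewrite /box big_mkcond.
by apply: measurable_prod => i _; case: (_ < _)%N => //; exact: measurable_ray.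
Qed.

Let measurable_cosdot (a : V) th : measurable_fun setT (fun x : V => cos (dotv a x + th)).
Proof.
apply: (measurableT_comp (@measurable_cosR R)); apply: measurable_funD => //.
exact: measurable_dotvr.
Qed.

Let bounded_int (P : probability V R) (f : V -> R) : measurable_fun setT f ->
  (forall x, `|f x| <= 1) -> P.-integrable setT (EFin \o f).
Proof. by move=> mf f1; exact: integrable_bounded f1. Qed.

Let box_cos_le1 b k (a : V) th x : `|box b k x * cos (dotv a x + th)| <= 1.
Proof.
rewrite normrM mulr_ile1 ?norm_cos_le1//.
by case/andP: (box01 b k x) => ? ?; rewrite ger0_norm.
Qed.

Let int_box_cos (P : probability V R) b k (a : V) th :
  P.-integrable setT (EFin \o (fun x => box b k x * cos (dotv a x + th))).
Proof.
by apply: bounded_int; [exact: measurable_funM|move=> x; exact: box_cos_le1].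
Qed.

(* One ray at a time: [1 + cos] is a nonnegative weight, and products of cosines
   are again sums of cosines of linear forms. *)
Lemma box_cos (b : 'I_n -> R) (k : nat) (a : V) th : (k <= n)%N ->
  \int[P1]_x (box b k x * cos (dotv a x + th)) = \int[P2]_x (box b k x * cos (dotv a x + th)).
Proof.
elim: k a th => [|k IH] a th kn.
  under eq_Rintegral do rewrite /box big_pred0 ?mul1r//.
  by under [RHS]eq_Rintegral do rewrite /box big_pred0 ?mul1r//.
pose k0 := Ordinal kn.
have boxS x : box b k.+1 x = box b k x * ray (b k0) (tnth x k0).
  rewrite /box (bigD1 k0)/= ?leqnn// mulrC; congr (_ * _); apply: eq_bigl => i.
  by rewrite ltnS ltn_neqAle andbC.
have step (a' : V) th' : \int[P1]_x (box b k x * (1 + cos (dotv a' x + th')) * ray (b k0) (tnth x k0)) =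
    \int[P2]_x (box b k x * (1 + cos (dotv a' x + th')) * ray (b k0) (tnth x k0)).
  apply: (@ray_determined _ _ _ (fun x => box b k x * (1 + cos (dotv a' x + th'))) (fun x => tnth x k0)).
  - by apply: measurable_funM => //; exact: measurable_funD.
  - move=> x; apply: mulr_ge0; first by case/andP: (box01 b k x).
    by have := cos_geN1 (dotv a' x + th'); lra.
  - move=> x; case/andP: (box01 b k x) => b0 b1.
    have c1 := cos_le1 (dotv a' x + th'); have c2 := cos_geN1 (dotv a' x + th').
    rewrite -[leRHS]mul1r ler_pM//; lra.
  - exact: measurable_tnthR.
  move=> z t.
  have E (P : probability V R) : \int[P]_x (box b k x * (1 + cos (dotv a' x + th')) * cos (z * tnth x k0 + t)) =
     \int[P]_x (box b k x * cos (dotv (scalev z (unitv k0)) x + t)) +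
     2^-1 * (\int[P]_x (box b k x * cos (dotv (vadd a' (scalev z (unitv k0))) x + (th' + t))) +
     \int[P]_x (box b k x * cos (dotv (vadd a' (scalev (- z) (unitv k0))) x + (th' - t)))).
    have i1 := int_box_cos P b k (scalev z (unitv k0)) t.
    have i2 := int_box_cos P b k (vadd a' (scalev z (unitv k0))) (th' + t).
    have i3 := int_box_cos P b k (vadd a' (scalev (- z) (unitv k0))) (th' - t).
    have i4 : P.-integrable setT (EFin \o (fun x => box b k x * cos (dotv (vadd a' (scalev z (unitv k0))) x + (th' + t)) +
       box b k x * cos (dotv (vadd a' (scalev (- z) (unitv k0))) x + (th' - t)))).
      exact: (integrableD measurableT i2 i3).
    have i5 : P.-integrable setT (EFin \o (fun x => 2^-1 * (box b k x * cos (dotv (vadd a' (scalev z (unitv k0))) x + (th' + t)) +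
       box b k x * cos (dotv (vadd a' (scalev (- z) (unitv k0))) x + (th' - t))))).
      exact: (integrableZl measurableT 2^-1 i4).
    rewrite -(RintegralD measurableT i2 i3) -(RintegralZl _ measurableT i4) -(RintegralD measurableT i1 i5).
    apply: eq_Rintegral => x _; rewrite !dotvDl !dotvZl dotv_unit.
    set A := dotv a' x + th'; set B := z * tnth x k0 + t.
    rewrite (_ : dotv a' x + z * tnth x k0 + (th' + t) = A + B); last by rewrite /A /B; ring.
    rewrite (_ : dotv a' x + - z * tnth x k0 + (th' - t) = A - B); last by rewrite /A /B; ring.
    by rewrite cosD cosB; field.
  by rewrite !E !(IH _ _ (ltnW kn)).
have int1 (P : probability V R) : P.-integrable setT (EFin \o (fun x => box b k.+1 x)).
  by apply: bounded_int => // x; case/andP: (box01 b k.+1 x) => ? ?; rewrite ger0_norm.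
have E (P : probability V R) a' th' :
   \int[P]_x (box b k x * (1 + cos (dotv a' x + th')) * ray (b k0) (tnth x k0)) =
   \int[P]_x box b k.+1 x + \int[P]_x (box b k.+1 x * cos (dotv a' x + th')).
  rewrite -(RintegralD measurableT (int1 P) (int_box_cos P b k.+1 a' th')).
  by apply: eq_Rintegral => x _; rewrite boxS; ring.
(* The zero form with phase 0 makes the weight constantly 2. This settles the unweighted integral,
   which is then subtracted from the one with weight 1 + cos. *)
have h0 : \int[P1]_x box b k.+1 x = \int[P2]_x box b k.+1 x.
  have := step zerov 0; rewrite !E.
  have z0 (P : probability V R) : \int[P]_x (box b k.+1 x * cos (dotv zerov x + 0)) = \int[P]_x box b k.+1 x.
    by apply: eq_Rintegral => x _; rewrite dotv0l addr0 cos0 mulr1.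
  by rewrite !z0; lra.
by have := step a th; rewrite !E h0 => /addrI.
Qed.

Definition orthant (b : 'I_n -> R) : set V := [set x | forall i, tnth x i <= b i].

Let box_orthant b x : box b n x = \1_(orthant b) x.
Proof.
rewrite indicE /box (eq_bigl xpredT) => [|i]; last by rewrite ltn_ord.
have [h|h] := pselect (orthant b x).
  rewrite mem_set// big1// => i _; rewrite /ray indicE mem_set//=.
  by rewrite in_itv/= h.
rewrite memNset//; have /existsNP[i hi] := h.
rewrite (bigD1 i)//= /ray indicE memNset ?mul0r//= in_itv/=.
Qed.

Lemma measurable_orthant b : measurable (orthant b).
Proof.
have -> : orthant b = \bigcap_(i in [set: 'I_n]) (fun x => tnth x i) @^-1` `]-oo, b i]%classic.
  apply/seteqP; split => x /= h i; first by move=> _ /=; rewrite in_itv/= h.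
  by have := h i Logic.I; rewrite /= in_itv.
apply: fin_bigcap_measurable => // i _.
by rewrite -[X in measurable X]setTI; exact: measurable_tnthR.
Qed.

Let orthants : set (set V) := [set orthant b | b in setT].

Lemma archi_norm (r : R) : exists k : nat, r <= k%:R.
Proof. by exists (Num.truncn `|r|).+1; rewrite (le_trans (ler_norm r))// ltW// truncnS_gt. Qed.

Lemma tuple_bound (x : V) : exists k : nat, forall i, tnth x i <= k%:R.
Proof.
have [k hk] := archi_norm (\sum_(i < n) `|tnth x i|).
exists k => i; rewrite (le_trans _ hk)// (bigD1 i)//= (le_trans (ler_norm _))// lerDl.
exact: sumr_ge0.
Qed.

(** A half-space x_i <= b is the countable union of the orthants with bound b at i and a natural
    number k at every other coordinate. *)
Lemma measurable_orthants : @measurable _ V = <<s orthants >>.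
Proof.
apply/seteqP; split; last first.
  apply: smallest_sub; first exact: sigma_algebra_measurable.
  by move=> _ [b _ <-]; exact: measurable_orthant.
apply: smallest_sub; first exact: smallest_sigma_algebra.
move=> A; rewrite -bigcup_seq => -[/= i _ [Y mY <-]].
have mi : measurable_fun setT (fun x : g_sigma_algebraType orthants => tnth x i).
  apply: (measurability _ (RGenOInfty.measurableE R)) => _ [_ [b ->] <-].
  rewrite setTI.
  have -> : (fun x : V => tnth x i) @^-1` `]b, +oo[%classic =
      ~` (\bigcup_(k in [set: nat]) orthant (fun j => if j == i then b else k%:R)).
    apply/seteqP; split => x /=; rewrite in_itv/= andbT.
      move=> bx [k _ /(_ i)]; rewrite eqxx => xb.
      by move: (lt_le_trans bx xb); rewrite ltxx.
    move=> h; rewrite ltNge; apply/negP => xb; apply: h.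
    have [k hk] := tuple_bound x; exists k => // j.
    by case: eqP => [->//|_].
  apply: measurableC; apply: bigcup_measurable => k _.
  by apply: sub_sigma_algebra; exists (fun j => if j == i then b else k%:R).
exact: mi.
Qed.

(** Orthants form a generating class stable under intersection, and those with constant natural
    bounds exhaust the space. Their measure is [box_cos] at k = n with the zero form. *)
Theorem cramer_wold A : measurable A -> P1 A = P2 A.
Proof.
apply: (measure_unique orthants (fun k => orthant (fun=> k%:R))) => //.
- exact: measurable_orthants.
- move=> _ _ [b _ <-] [c _ <-]; exists (fun i => Num.min (b i) (c i)) => //.
  apply/seteqP; split => x /=; rewrite /orthant/=.
    by move=> h; split => i; have := h i; rewrite le_min => /andP[].
  by move=> [h1 h2] i; rewrite le_min h1 h2.
- by move=> k; exists (fun=> k%:R).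
- apply/seteqP; split => // x _; have [k hk] := tuple_bound x; by exists k.
- move=> _ [b _ <-].
  have E (P : probability V R) : (\int[P]_x (box b n x * cos (dotv zerov x + 0)))%:E = P (orthant b).
    rewrite (@integral_bounded_fin _ _ _ P _ 1); last 2 first.
    + exact: measurable_funM.
    + by move=> x; exact: box_cos_le1.
    have := @integral_indic _ _ _ P setT measurableT _ (measurable_orthant b).
    rewrite setIT => <-; apply: eq_integral => x _.
    by rewrite dotv0l addr0 cos0 mulr1 box_orthant.
  by apply: (etrans (esym (E P1))); rewrite box_cos//; exact: E.
- move=> k; apply: le_lt_trans (ltry 1); apply: probability_le1.
  exact: measurable_orthant.
Qed.

End cramer_wold.

(** * Standard Gaussian vectors and linear changes of variables *)

Section Rintegral_distribution.
Context d1 d2 (T1 : measurableType d1) (T2 : measurableType d2) (R : realType).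

Lemma Rintegral_distribution (P : probability T1 R) (X : {mfun T1 >-> T2}) (f : T2 -> R) (C : R) :
  measurable_fun setT f -> (forall y, `|f y| <= C) ->
  \int[distribution P X]_y f y = \int[P]_x f (X x).
Proof.
move=> mf fC; rewrite /Rintegral; congr fine.
rewrite integral_distribution//; first exact/measurable_EFinP.
by apply: (@integrable_bounded _ _ _ P (fun x => f (X x)) C) => //; exact: measurableT_comp.
Qed.

End Rintegral_distribution.

Section standard_gaussian.
Context (R : realType).
Notation N := (stdN R).

Definition consv n (z : R * vec R n) : vec R n.+1 := [tuple of z.1 :: z.2].

Lemma measurable_consv n : measurable_fun setT (@consv n).
Proof. exact: measurable_cons. Qed.

HB.instance Definition _ n := isMeasurableFun.Build _ _ _ _ (@consv n) (@measurable_consv n).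

Fixpoint gaussv n : probability (vec R n) R :=
  match n with
  | 0 => dirac ([tuple] : vec R 0)
  | k.+1 => distribution (N \x gaussv k)%E (@consv k)
  end.

Lemma ge0_integral_gaussvS n (f : vec R n.+1 -> \bar R) :
  measurable_fun setT f -> (forall z, 0 <= f z)%E ->
  (\int[gaussv n.+1]_z f z = \int[N]_x \int[gaussv n]_t f (consv (x, t)))%E.
Proof.
move=> mf f0; rewrite /= ge0_integral_distribution//.
rewrite (fubini_tonelli1 (fun z => f (consv z)))//.
by apply: measurableT_comp => //; exact: measurable_consv.
Qed.

Lemma tnth_consv0 n (z : R * vec R n) : tnth (consv z) ord0 = z.1.
Proof. by []. Qed.

Lemma tnth_consvS n (z : R * vec R n) i : tnth (consv z) (lift ord0 i) = tnth z.2 i.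
Proof. exact: tnthS. Qed.

Lemma dotv_cons n (y z : R * vec R n) :
  dotv (consv y) (consv z) = y.1 * z.1 + dotv y.2 z.2.
Proof.
rewrite /dotv big_ord_recl !tnth_consv0; congr (_ + _).
by apply: eq_bigr => i _; rewrite !tnth_consvS.
Qed.

Lemma consv_eta n (a : vec R n.+1) : a = consv (thead a, [tuple of behead a]).
Proof. exact: tuple_eta. Qed.

(** Once the first coordinate is fixed, it only changes the phase of the cosine in the tail; the
    free [th] is what makes the induction go through. *)
Lemma gaussv_cos n (a : vec R n) th :
  \int[gaussv n]_z cos (dotv a z + th) = cos th * expR (- (dotv a a / 2)).
Proof.
elim: n a th => [|n IH] a th.
  rewrite (@eq_Rintegral _ _ _ _ _ (fun=> cos th)); last first.
    by move=> z _; rewrite /dotv big_ord0 add0r.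
  by rewrite Rintegral_prob_cst /dotv big_ord0 mul0r oppr0 expR0 mulr1.
rewrite {1}(consv_eta a); move: (thead a) ([tuple of behead a]) (consv_eta a) => a0 a' ->.
have mc : measurable_fun setT (fun z : vec R n.+1 => cos (dotv (consv (a0, a')) z + th)).
  apply: (measurableT_comp (@measurable_cosR R)); apply: measurable_funD => //.
  exact: measurable_dotvr.
rewrite [LHS](@Rintegral_distribution _ _ _ _ _ _ _ _ 1 mc); last by move=> y; exact: norm_cos_le1.
have mc' : measurable_fun setT (fun z : R * vec R n => cos (dotv (consv (a0, a')) (consv z) + th)).
  by apply: (measurableT_comp mc); exact: measurable_consv.
rewrite (@Rintegral_prod _ _ _ _ _ _ _ _ 1 mc'); last by move=> y; exact: norm_cos_le1.
rewrite (@eq_Rintegral _ _ _ _ _ (fun x => cos (a0 * x + th) * expR (- (dotv a' a' / 2)))); last first.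
  move=> x _; rewrite -IH; apply: eq_Rintegral => t _.
  by rewrite dotv_cons/=; congr cos; ring.
rewrite RintegralZr//; last first.
  apply: (@integrable_bounded _ _ _ N _ 1); first exact: measurable_cos_lin.
  by move=> x; exact: norm_cos_le1.
rewrite stdN_cos -mulrA -expRD dotv_cons/=; congr (_ * expR _); ring.
Qed.

Lemma measurable_expR_sqnorm n : measurable_fun setT (fun z : vec R n => (expR (dotv z z / 2))%:E : \bar R).
Proof.
apply/measurable_EFinP; apply: measurableT_comp => //; apply: measurable_funM => //.
exact: measurable_dotv.
Qed.

(* A constant multiple of the Lebesgue integral on R^n. *)
Definition lebint n (f : vec R n -> \bar R) : \bar R :=
  (\int[gaussv n]_z (f z * (expR (dotv z z / 2))%:E))%E.

Lemma gaussv_lebint n (f : vec R n -> \bar R) :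
  (\int[gaussv n]_z f z = lebint (fun z => f z * (expR (- (dotv z z / 2)))%:E))%E.
Proof.
by apply: eq_integral => z _; rewrite -muleA -EFinM -expRD addNr expR0 mule1.
Qed.

Lemma lebint_ge0 n (f : vec R n -> \bar R) : (forall z, 0 <= f z)%E -> (0 <= lebint f)%E.
Proof. by move=> f0; apply: integral_ge0 => z _; rewrite mule_ge0// lee_fin expR_ge0. Qed.

Lemma lebintZl n (c : R) (f : vec R n -> \bar R) : 0 <= c ->
  measurable_fun setT f -> (forall z, 0 <= f z)%E ->
  (lebint (fun z => c%:E * f z) = c%:E * lebint f)%E.
Proof.
move=> c0 mf f0; rewrite /lebint -ge0_integralZl//.
- by apply: eq_integral => z _; rewrite muleA.
- by apply: emeasurable_funM => //; exact: measurable_expR_sqnorm.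
- by move=> z _; rewrite mule_ge0// lee_fin expR_ge0.
Qed.

Lemma measurable_consv_section n x (f : vec R n.+1 -> \bar R) :
  measurable_fun setT f -> measurable_fun setT (fun t => f (consv (x, t))).
Proof.
move=> mf; apply: (measurableT_comp mf).
exact: (@measurable_cons _ _ _ _ (cst x) n id).
Qed.

Lemma measurable_lebint_section n (f : vec R n.+1 -> \bar R) :
  measurable_fun setT f -> (forall z, 0 <= f z)%E ->
  measurable_fun setT (fun x => lebint (fun t => f (consv (x, t)))).
Proof.
move=> mf f0.
apply: (measurable_fun_fubini_tonelli_F (fun z : R * vec R n => f (consv z) * (expR (dotv z.2 z.2 / 2))%:E)%E).
  apply: emeasurable_funM; first by apply: (measurableT_comp mf); exact: measurable_consv.
  exact: (measurableT_comp (@measurable_expR_sqnorm n)).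
by move=> z; rewrite mule_ge0// lee_fin expR_ge0.
Qed.

Lemma lebintS n (f : vec R n.+1 -> \bar R) :
  measurable_fun setT f -> (forall z, 0 <= f z)%E ->
  lebint f = (\int[N]_x (lebint (fun t => f (consv (x, t))) * (expR (x ^+ 2 / 2))%:E))%E.
Proof.
move=> mf f0; rewrite {1}/lebint ge0_integral_gaussvS; last 2 first.
- by apply: emeasurable_funM => //; exact: measurable_expR_sqnorm.
- by move=> z; rewrite mule_ge0// lee_fin expR_ge0.
apply: eq_integral => x _; rewrite /lebint -ge0_integralZr//.
- apply: eq_integral => t _; rewrite dotv_cons/= mulrDl expRD EFinM -expr2.
  by rewrite -muleA; congr (_ * _)%E; rewrite muleC.
- apply: emeasurable_funM; last exact: measurable_expR_sqnorm.
  exact: measurable_consv_section.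
- by move=> t _; rewrite mule_ge0// lee_fin expR_ge0.
Qed.

(** The weight exp(x^2/2) undoes the Gaussian density, so of [affine_density] only the Jacobian 1/s
    survives and the shift has no effect. *)
Lemma lebint1_affine (m s : R) (f : R -> \bar R) : 0 < s ->
  measurable_fun setT f -> (forall x, 0 <= f x)%E ->
  (\int[N]_x (f (m + s * x)%R * (expR (x ^+ 2 / 2))%:E) =
   s^-1%:E * \int[N]_x (f x * (expR (x ^+ 2 / 2))%:E))%E.
Proof.
move=> s0 mf f0; have sN0 : s != 0 by rewrite gt_eqF.
pose g x : \bar R := (f x * (expR (((x - m) / s) ^+ 2 / 2))%:E)%E.
have mg : measurable_fun setT g.
  apply: emeasurable_funM => //; apply/measurable_EFinP; apply: measurableT_comp => //.
  by apply: measurable_funM => //; apply: measurable_funX; apply: measurable_funM => //; exact: measurable_funB.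
have g0 x : (0 <= g x)%E by rewrite mule_ge0// lee_fin expR_ge0.
have := ge0_stdN_affine m s0 mg g0.
rewrite (_ : (\int[N]_x g (m + s * x)%R)%E = (\int[N]_x (f (m + s * x)%R * (expR (x ^+ 2 / 2))%:E))%E); last first.
  apply: eq_integral => x _; rewrite /g; congr (_ * (expR (_ ^+ 2 / 2))%:E)%E.
  by rewrite addrAC subrr add0r mulrAC divff// mul1r.
move=> <-; rewrite -ge0_integralZl//.
- apply: eq_integral => x _; rewrite /g /affine_density -!muleA -EFinM muleCA -EFinM.
  congr (_ * _%:E)%E; rewrite mulrCA -expRD; congr (_ * expR _); ring.
- apply: emeasurable_funM => //; apply/measurable_EFinP; apply: measurableT_comp => //.
  by apply: measurable_funM => //; exact: measurable_funX.
- by move=> x _; rewrite mule_ge0// lee_fin expR_ge0.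
- by rewrite lee_fin invr_ge0 ltW.
Qed.

End standard_gaussian.

(** * Matrices acting on R^n *)

Section linear_maps.
Context {R : realType} {n : nat}.
Implicit Types (F G : 'M[R]_n) (a m x z : vec R n).

Definition mulv F z : vec R n := [tuple \sum_j F i j * tnth z j | i < n].

Lemma tnth_mulv F z i : tnth (mulv F z) i = \sum_j F i j * tnth z j.
Proof. by rewrite tnth_mktuple. Qed.

Lemma tnth_vadd x z i : tnth (vadd x z) i = tnth x i + tnth z i.
Proof. by rewrite tnth_mktuple. Qed.

Lemma mulvM F G z : mulv (F *m G) z = mulv F (mulv G z).
Proof.
apply: eq_from_tnth => i; rewrite !tnth_mulv.
under eq_bigr do rewrite mxE mulr_suml.
rewrite exchange_big; apply: eq_bigr => k _; rewrite tnth_mulv mulr_sumr.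
by apply: eq_bigr => j _; rewrite mulrA.
Qed.

Lemma mulv1 z : mulv 1%:M z = z.
Proof.
apply: eq_from_tnth => i; rewrite tnth_mulv (bigD1 i)//= mxE eqxx mul1r.
by rewrite big1 ?addr0// => j ji; rewrite mxE eq_sym (negbTE ji) mul0r.
Qed.

Lemma mulvDr F x z : mulv F (vadd x z) = vadd (mulv F x) (mulv F z).
Proof.
apply: eq_from_tnth => i; rewrite tnth_vadd !tnth_mulv -big_split.
by apply: eq_bigr => j _; rewrite tnth_vadd mulrDr.
Qed.

Lemma mulvZ F c z : mulv F (scalev c z) = scalev c (mulv F z).
Proof.
apply: eq_from_tnth => i; rewrite tnth_mulv !tnth_mktuple mulr_sumr.
by apply: eq_bigr => j _; rewrite tnth_mktuple mulrCA.
Qed.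

Lemma mulNv F z : mulv (- F) z = scalev (-1) (mulv F z).
Proof.
apply: eq_from_tnth => i; rewrite tnth_mulv !tnth_mktuple mulN1r -sumrN.
by apply: eq_bigr => j _; rewrite mxE mulNr.
Qed.

Lemma dotv_mulv a F z : dotv a (mulv F z) = dotv (mulv F^T a) z.
Proof.
rewrite /dotv; under eq_bigr do rewrite tnth_mulv mulr_sumr.
rewrite exchange_big; apply: eq_bigr => j _; rewrite tnth_mulv mulr_suml.
by apply: eq_bigr => i _; rewrite mxE; ring.
Qed.

Lemma dotvDr a x z : dotv a (vadd x z) = dotv a x + dotv a z.
Proof. by rewrite dotvC dotvDl !(dotvC a). Qed.

Lemma quadform_dotv (S : 'M[R]_n) a : quadform S a = dotv a (mulv S a).
Proof.
apply: eq_bigr => i _; rewrite tnth_mulv mulr_sumr.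
by apply: eq_bigr => j _; rewrite mulrA.
Qed.

Lemma quadform_gram F a : quadform (F *m F^T) a = dotv (mulv F^T a) (mulv F^T a).
Proof. by rewrite quadform_dotv mulvM dotv_mulv. Qed.

Lemma vaddK m x : vadd (scalev (-1) m) (vadd m x) = x.
Proof.
apply: eq_from_tnth => i; rewrite !tnth_vadd tnth_mktuple.
by rewrite mulN1r addKr.
Qed.

Lemma measurable_mulv F : measurable_fun setT (mulv F).
Proof.
apply/measurable_fun_tnthP => i.
rewrite (_ : _ \o _ = fun z : vec R n => \sum_j F i j * tnth z j); last first.
  by apply/funext => z /=; rewrite tnth_mulv.
by apply: measurable_sum => j; apply: measurable_funM => //; exact: measurable_tnthR.
Qed.

Lemma measurable_vadd d (T : measurableType d) (f g : T -> vec R n) :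
  measurable_fun setT f -> measurable_fun setT g ->
  measurable_fun setT (fun t : T => vadd (f t) (g t)).
Proof.
move=> mf mg; apply/measurable_fun_tnthP => i.
rewrite (_ : _ \o _ = fun t => tnth (f t) i + tnth (g t) i); last first.
  by apply/funext => t /=; rewrite tnth_vadd.
by apply: measurable_funD; apply: (measurableT_comp (measurable_tnthR i)).
Qed.

End linear_maps.

(** * Cholesky factors and triangular changes of variables *)

Section cholesky.
Context (R : realType).

(* Replaces the change of variables formula; [c] is [|det F|^-1]. *)
Definition lebint_scaled n (F : 'M[R]_n) := exists2 c : R, 0 < c &
  forall (m : vec R n) (f : vec R n -> \bar R), measurable_fun setT f ->
    (forall z, 0 <= f z)%E ->
    (lebint (fun z => f (vadd m (mulv F z))) = c%:E * lebint f)%E.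

(** For a fixed first coordinate [x] the tail undergoes an affine map with linear part [F] and a
    shift depending on [x]; hence the quantification over [m] in [lebint_scaled]. *)
Lemma affine_block n (s : R) (v : 'cV[R]_n) (F : 'M[R]_n) (m0 x : R) (m t : vec R n) :
  vadd (consv (m0, m)) (mulv (block_mx s%:M 0 v F : 'M[R]_n.+1) (consv (x, t))) =
  consv (m0 + s * x, vadd (vadd m [tuple v i 0 * x | i < n]) (mulv F t)).
Proof.
pose B : 'M[R]_n.+1 := block_mx s%:M 0 v F; rewrite -[X in mulv X _]/B.
have e00 : B ord0 ord0 = s.
  transitivity ((s%:M : 'M[R]_1) ord0 ord0); last by rewrite mxE eqxx mulr1n.
  by rewrite -(@block_mxEul R 1 n 1 n s%:M 0 v F) !lshift0.
have e01 k : B ord0 (lift ord0 k) = 0.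
  transitivity ((0 : 'rV[R]_n) ord0 k); last by rewrite mxE.
  by rewrite -(@block_mxEur R 1 n 1 n s%:M 0 v F) lshift0 rshift1.
have e10 k : B (lift ord0 k) ord0 = v k 0.
  by have := @block_mxEdl R 1 n 1 n s%:M 0 v F k ord0; rewrite lshift0 rshift1.
have e11 k l : B (lift ord0 k) (lift ord0 l) = F k l.
  by have := @block_mxEdr R 1 n 1 n s%:M 0 v F k l; rewrite !rshift1.
apply: eq_from_tnth => i; rewrite tnth_vadd tnth_mulv.
have [->|[j ->]] : i = ord0 \/ exists j, i = lift ord0 j.
  by case: (unliftP ord0 i) => [j ->|->]; [right; exists j|left].
  rewrite !tnth_consv0/=; congr (_ + _).
  rewrite big_ord_recl tnth_consv0/= e00.
  by rewrite big1 ?addr0// => k _; rewrite e01 mul0r.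
rewrite !tnth_consvS/= !tnth_vadd tnth_mulv tnth_mktuple -addrA; congr (_ + _).
rewrite big_ord_recl tnth_consv0/= e10; congr (_ + _).
by apply: eq_bigr => k _; rewrite tnth_consvS e11.
Qed.

(** The integral over the tail yields the factor [c], the one over the first coordinate yields
    1/s. *)
Lemma lebint_scaled_block n (s : R) (v : 'cV[R]_n) (F : 'M[R]_n) : 0 < s ->
  lebint_scaled F -> lebint_scaled (block_mx s%:M 0 v F : 'M[R]_n.+1).
Proof.
move=> s0 [c c0 hc]; exists (s^-1 * c); first by rewrite mulr_gt0 ?invr_gt0.
move=> m f mf f0; rewrite (consv_eta m); move: (thead m) [tuple of behead m] => m0 {}m.
have mfa : measurable_fun setT (fun z => f (vadd (consv (m0, m)) (mulv (block_mx s%:M 0 v F : 'M[R]_n.+1) z))).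
  apply: (measurableT_comp mf); apply: measurable_vadd => //; exact: measurable_mulv.
have mls := measurable_lebint_section mf f0.
rewrite (lebintS mfa)// (lebintS mf)//.
transitivity (\int[stdN R]_x (c%:E * (lebint (fun t => f (consv ((m0 + s * x)%R, t))) * (expR (x ^+ 2 / 2))%:E)))%E.
  apply: eq_integral => x _; rewrite muleA -(hc (vadd m [tuple v i 0 * x | i < n]) (fun t => f (consv ((m0 + s * x)%R, t))))//; last exact: measurable_consv_section.
  congr (_ * _)%E; apply: eq_integral => t _; congr (_ * _)%E.
  by rewrite affine_block.
have me : measurable_fun setT (fun x : R => (expR (x ^+ 2 / 2))%:E : \bar R).
  apply/measurable_EFinP; apply: measurableT_comp => //.
  by apply: measurable_funM => //; exact: measurable_funX.
have mX : measurable_fun setT (fun x : R => lebint (fun t => f (consv ((m0 + s * x)%R, t))) * (expR (x ^+ 2 / 2))%:E)%E.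
  by apply: emeasurable_funM => //; apply: (measurableT_comp mls); exact: measurable_affine.
have X0 (x : R) : setT x -> (0 <= lebint (fun t => f (consv ((m0 + s * x)%R, t))) * (expR (x ^+ 2 / 2))%:E)%E.
  by move=> _; rewrite mule_ge0 ?lebint_ge0// lee_fin expR_ge0.
have c0' : (0 <= c%:E)%E by rewrite lee_fin ltW.
rewrite (ge0_integralZl (stdN R) measurableT mX X0 c0').
rewrite (lebint1_affine m0 s0 mls); last by move=> x; exact: lebint_ge0.
by rewrite muleA -EFinM (mulrC c).
Qed.

Let q n (S : 'M[R]_n) (u : 'rV[R]_n) : R := (u *m S *m u^T) 0 0.

Lemma q_block n (s : R) (v : 'cV[R]_n) (S : 'M[R]_n) (t : R) (w : 'rV[R]_n) :
  @q (1 + n) (block_mx s%:M v^T v S) (row_mx t%:M w) =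
  t ^+ 2 * s + 2 * t * (w *m v) 0 0 + q S w.
Proof.
rewrite /q mul_row_block tr_row_mx mul_row_col tr_scalar_mx mul_mx_scalar -scalar_mxM.
rewrite mul_scalar_mx mulmxDl -scalemxAl -trmx_mul 2!mxE [X in _ * X + _ = _]mxE.
rewrite [X in _ * (X + _) + _ = _]mxE eqxx mulr1n [X in _ + X = _]mxE [X in _ + (X + _) = _]mxE.
by rewrite [X in _ + (_ * X + _) = _]mxE; ring.
Qed.

(** Induction on the Schur complement of the corner entry s. When s = 0, nonnegativity kills the
    rest of the first column, so singular forms are factored too. For a definite form all pivots are
    positive and [lebint_scaled_block] applies at each stage. *)
Lemma cholesky n (S : 'M[R]_n) : S^T = S -> (forall u, 0 <= q S u) ->
  exists F : 'M[R]_n, F *m F^T = S /\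
   ((forall u, u != 0 -> 0 < q S u) -> F \in unitmx /\ lebint_scaled F).
Proof.
elim: n S => [|n IH] S St S0.
  exists 1%:M; split; first by apply/matrixP => -[].
  move=> _; split; first exact: unitmx1.
  exists 1 => // m f mf f0; rewrite mul1e; congr lebint; apply/funext => z.
  by congr f; apply: eq_from_tnth => -[].
have [s [v [S' SE]]] : exists s (v : 'cV[R]_n) (S' : 'M[R]_n), S = block_mx s%:M v^T v S' :> 'M[R]_(1 + n).
  exists (S ord0 ord0), (dlsubmx (S : 'M[R]_(1 + n))), (drsubmx (S : 'M[R]_(1 + n))).
  rewrite -[LHS](@submxK _ 1 n 1 n); congr block_mx.
    by rewrite [ulsubmx _]mx11_scalar !mxE !lshift0.
  by rewrite trmx_dlsub St.
have S't : S'^T = S'.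
  by move: St; rewrite SE (@tr_block_mx _ 1 n 1 n) => /(@eq_block_mx _ 1 n 1 n)[_ _ _].
subst S.
have s0 : 0 <= s by have := S0 (row_mx 1%:M 0); rewrite q_block /q !mul0mx mxE; lra.
have [s00|sN0] := eqVneq s 0.
  have v0 : v = 0.
    have cE : (v^T *m v) 0 0 = \sum_i v i 0 ^+ 2.
      by rewrite mxE; apply: eq_bigr => i _; rewrite mxE.
    have c0 : (v^T *m v) 0 0 = 0.
      apply/eqP; rewrite eq_le; apply/andP; split; last by rewrite cE sumr_ge0// => i _; exact: sqr_ge0.
      rewrite leNgt; apply/negP => cgt0.
      (* With s = 0 the form is affine in the first coordinate; this choice gives it the value
         -1. *)
      have := S0 (row_mx (- (q S' v^T + 1) / (2 * (v^T *m v) 0 0))%:M v^T).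
      rewrite q_block s00 mulr0 add0r; move: ((v^T *m v) 0 0) cgt0 (q S' v^T) => c c0 d.
      have -> : 2 * (- (d + 1) / (2 * c)) * c + d = -1 by field; rewrite gt_eqF.
      lra.
    apply/matrixP => i j; rewrite ord1 mxE; move/eqP: c0; rewrite cE psumr_eq0; last by move=> k _; exact: sqr_ge0.
    by move=> /allP/(_ i (mem_index_enum _)); rewrite sqrf_eq0 => /eqP.
  have [F [FE _]] := IH S' S't (fun w => ltac:(by have := S0 (row_mx 0%:M w); rewrite q_block expr0n/= !(mul0r, mulr0) !add0r)).
  exists (block_mx 0 0 0 F : 'M[R]_(1 + n)); split.
    rewrite (@tr_block_mx _ 1 n 1 n) (@mulmx_block _ 1 n 1 n 1 n) FE v0 s00 !(trmx0, mul0mx, mulmx0, addr0, add0r).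
    by rewrite (_ : (0 : R)%:M = 0 :> 'M[R]_1)//; exact: raddf0.
  move=> /(_ (row_mx 1%:M 0)); rewrite q_block s00 v0 /q !(mulmx0, mul0mx) !mxE => h.
  exfalso; suff /h : row_mx 1%:M 0 != 0 :> 'rV[R]_(1 + n) by lra.
  apply/eqP => /(congr1 (fun u : 'rV[R]_(1 + n) => u 0 (lshift n 0))); rewrite row_mxEl !mxE => /eqP.
  by rewrite oner_eq0.
have sgt0 : 0 < s by rewrite lt_neqAle eq_sym sN0.
pose S1 := S' - s^-1 *: (v *m v^T).
have S1t : S1^T = S1 by rewrite /S1 linearB/= linearZ/= trmx_mul trmxK S't.
(* The first coordinate -(w v)/s minimises the full form at fixed [w], and the minimum is the form
   of the Schur complement; signs are thus inherited. *)
have S1q w : q S1 w = @q (1 + n) (block_mx s%:M v^T v S') (row_mx (- (s^-1 * (w *m v) 0 0))%:M w).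
  rewrite q_block /q /S1 mulmxBr mulmxBl [in LHS]mxE [X in _ + X]mxE -scalemxAr -scalemxAl [X in _ - X]mxE.
  rewrite mulmxA -(mulmxA (w *m v)) -trmx_mul [X in _ - _ * X]mxE big_ord1 [X in _ - _ * (_ * X)]mxE.
  by move: ((w *m v) 0 0) ((w *m S' *m w^T) 0 0) => a b; field.
have [F [FE FP]] := IH S1 S1t (fun w => ltac:(by rewrite S1q)).
have r0 : 0 < Num.sqrt s by rewrite sqrtr_gt0.
exists (block_mx (Num.sqrt s)%:M 0 ((Num.sqrt s)^-1 *: v) F : 'M[R]_(1 + n)); split.
  rewrite (@tr_block_mx _ 1 n 1 n) (@mulmx_block _ 1 n 1 n 1 n) FE.
  rewrite !(trmx0, mul0mx, mulmx0, addr0, add0r) tr_scalar_mx -!scalar_mxM.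
  have e1 : (Num.sqrt s)%:M *m ((Num.sqrt s)^-1 *: v)^T = v^T.
    by rewrite linearZ/= mul_scalar_mx scalerA divff ?scale1r// gt_eqF.
  have e2 : (Num.sqrt s)^-1 *: v *m (Num.sqrt s)%:M = v.
    by rewrite mul_mx_scalar scalerA divff ?scale1r// gt_eqF.
  have e3 : (Num.sqrt s)^-1 *: v *m ((Num.sqrt s)^-1 *: v)^T + S1 = S'.
    rewrite /S1 linearZ/= -scalemxAl -scalemxAr scalerA -invfM -expr2 sqr_sqrtr//.
    by rewrite addrC subrK.
  by rewrite e1 e2 e3 -expr2 sqr_sqrtr.
move=> Sp; have [] := FP.
  move=> w w0; rewrite S1q; apply: Sp; apply: contra w0 => /eqP h.
  by apply/eqP; have := congr1 (@rsubmx _ 1 1 n) h; rewrite row_mxKr => ->; rewrite linear0.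
move=> Fu Fl; split; last exact: lebint_scaled_block.
by rewrite unitmxE (@det_lblock _ 1 n) det_scalar1 unitrM -unitmxE Fu andbT unitfE gt_eqF.
Qed.

End cholesky.

(** * Kullback-Leibler divergence *)

Section KL.
Context d (T : measurableType d) (R : realType).
Implicit Types P Q : probability T R.

(** The derivative is unique up to [Q]-null sets, hence up to [P]-null sets. An exponential density
    is positive everywhere, so [ln] recovers [g]. *)
Lemma KLdiv_density P Q (g : T -> R) : measurable_fun setT g ->
  (forall A, measurable A -> P A = \int[Q]_(x in A) (expR (g x))%:E)%E ->
  KLdiv P Q = (\int[P]_x (g x)%:E)%E.
Proof.
move=> mg PQ.
have meg : measurable_fun setT (fun x => (expR (g x))%:E : \bar R).
  by apply/measurable_EFinP; exact: measurableT_comp.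
have dom : P `<< Q.
  apply/null_content_dominatesP => A mA A0; rewrite PQ//.
  by apply: null_set_integral => //; exact: measurable_funTS.
rewrite /KLdiv; case: pselect => // dom'.
have aeQ : ae_eq Q setT (Radon_Nikodym (charge_of_finite_measure P) Q) (fun x => (expR (g x))%:E).
  apply: integral_ae_eq => //; first exact: Radon_Nikodym_integrable.
  by move=> A _ mA; rewrite -Radon_Nikodym_integral// -PQ.
have aeP : ae_eq P setT (Radon_Nikodym (charge_of_finite_measure P) Q) (fun x => (expR (g x))%:E).
  exact: null_dominates_ae_eq aeQ.
apply: ae_eq_integral => //.
- apply/measurable_EFinP; apply: measurableT_comp => //; exact: measurableT_comp.
- exact/measurable_EFinP.
- apply: filterS aeP => x /= h _; rewrite h//= expRK//.
Qed.

(** Meant for [f] a log-density, whose integral may be +oo; positive and negative parts are compared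
    separately. *)
Lemma le_integral_lower (mu : {measure set T -> \bar R}) (f g : T -> \bar R) :
  measurable_fun setT f -> mu.-integrable setT g -> (forall x, g x <= f x)%E ->
  (\int[mu]_x g x <= \int[mu]_x f x)%E.
Proof.
move=> mf ig gf.
have mg : measurable_fun setT g by exact: measurable_int ig.
rewrite (integralE _ _ g) (integralE _ _ f); apply: leeB.
- apply: ge0_le_integral => //; try exact: measurable_funepos.
  by move=> x _; rewrite !funeposE ge_max le_max gf/= le_max lexx orbT.
- apply: ge0_le_integral => //; try exact: measurable_funeneg.
  by move=> x _; rewrite !funenegE ge_max le_max leeN2 gf/= le_max lexx orbT.
Qed.

(** Let r = dP/dQ. The inequality exp u >= 1 + u at u = g - ln r reads ln r >= g + 1 - exp(g)/r, and
    the [P]-integral of exp(g)/r is at most the [Q]-integral of exp g, hence at most 1. *)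
Lemma KLdiv_ge P Q (g : T -> R) : measurable_fun setT g ->
  P.-integrable setT (EFin \o g) -> (\int[Q]_x (expR (g x))%:E <= 1)%E ->
  (\int[P]_x (g x)%:E <= KLdiv P Q)%E.
Proof.
move=> mg ig g1; rewrite /KLdiv; case: pselect => [dom|ndom]; last exact: leey.
rewrite /=.
set r := Radon_Nikodym _ _.
have mr : measurable_fun setT r by exact: measurable_int (Radon_Nikodym_integrable _).
(* A version of the derivative that is nonnegative and finite at every point. *)
pose f := Radon_Nikodym_SigmaFinite.f P Q.
have mf : measurable_fun setT f by exact: measurable_int (Radon_Nikodym_SigmaFinite.f_integrable _).
have fr : ae_eq P setT f r.
  by apply: (null_dominates_ae_eq measurableT dom); exact: ae_eq_Radon_Nikodym_SigmaFinite.
have -> : (\int[P]_x (ln (fine (r x)))%:E = \int[P]_x (ln (fine (f x)))%:E)%E.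
  apply: ae_eq_integral => //.
  - apply/measurable_EFinP; apply: measurableT_comp => //; exact: measurableT_comp.
  - apply/measurable_EFinP; apply: measurableT_comp => //; exact: measurableT_comp.
  - by apply: filterS fr => x /= h _; rewrite h.
have f0 := Radon_Nikodym_SigmaFinite.f_ge0 dom.
have ffin := Radon_Nikodym_SigmaFinite.f_fin_num dom.
have mlf : measurable_fun setT (fun x => ln (fine (f x))).
  by apply: measurableT_comp => //; exact: measurableT_comp.
pose h x : R := expR (g x - ln (fine (f x))).
have mh : measurable_fun setT h by apply: measurableT_comp => //; exact: measurable_funB.
have h0 x : 0 <= h x by rewrite expR_ge0.
have hint : (\int[P]_x (h x)%:E <= 1)%E.
  rewrite -(Radon_Nikodym_SigmaFinite.change_of_variables dom)//; last first.
    exact/measurable_EFinP.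
  apply: le_trans g1; apply: ge0_le_integral => //.
  - by move=> x _; rewrite mule_ge0// lee_fin.
  - by apply: emeasurable_funM => //; exact/measurable_EFinP.
  - by apply/measurable_EFinP; exact: measurableT_comp.
  move=> x _; rewrite -[X in (_ * X)%E](fineK (ffin x)) -EFinM lee_fin /h.
  (* Where the density vanishes, [ln] takes a default value and [h] is meaningless, but the factor
     [f x] makes the product zero. *)
  have [->|fx0] := eqVneq (fine (f x)) 0; first by rewrite mulr0 expR_ge0.
  have fx : 0 < fine (f x) by rewrite lt_neqAle eq_sym fx0 fine_ge0.
  by rewrite expRB lnK ?posrE// divfK.
have ih : P.-integrable setT (EFin \o h).
  apply/integrableP; split; first exact/measurable_EFinP.
  under eq_integral do rewrite /= ger0_norm//.
  by rewrite (le_lt_trans hint)// ltry.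
have i1 : P.-integrable setT (EFin \o (fun=> 1 : R)).
  by apply: (@integrable_bounded _ _ _ P (fun=> 1) 1) => // x; rewrite normr1.
have ig1 : P.-integrable setT (EFin \o (fun x => g x + 1)) by exact: (integrableD measurableT ig i1).
have igh : P.-integrable setT (EFin \o (fun x => g x + 1 - h x)) by exact: (integrableB measurableT ig1 ih).
apply: (@le_trans _ _ (\int[P]_x (g x + 1 - h x)%:E)%E); last first.
  apply: le_integral_lower => //; first exact/measurable_EFinP.
  by move=> x; rewrite lee_fin; have := expR_ge1Dx (g x - ln (fine (f x))); rewrite /h; lra.
have fin (u : T -> R) : P.-integrable setT (EFin \o u) -> (\int[P]_x (u x)%:E)%E = (\int[P]_x u x)%:E.
  by move=> iu; rewrite fineK//; exact: integrable_fin_num.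
rewrite (fin _ ig) (fin _ igh) lee_fin (RintegralB measurableT ig1 ih) (RintegralD measurableT ig i1).
rewrite Rintegral_prob_cst; move: hint; rewrite (fin _ ih) lee_fin; lra.
Qed.

End KL.

(** * Gaussian vectors *)

Section law_of_function.
Context d1 d2 (T1 : measurableType d1) (T2 : measurableType d2) (R : realType).

(* A name to which the measurability proof can be attached as an instance. *)
Definition mwrap (f : T1 -> T2) (mf : measurable_fun setT f) : T1 -> T2 := f.

HB.instance Definition _ f mf := isMeasurableFun.Build _ _ _ _ (@mwrap f mf) mf.

Definition law (P : probability T1 R) (f : T1 -> T2) (mf : measurable_fun setT f) :
  probability T2 R := distribution P (mwrap mf).

Lemma lawE P f mf A : @law P f mf A = P (f @^-1` A).
Proof. by []. Qed.

Lemma Rintegral_law P f mf (g : T2 -> R) C : measurable_fun setT g ->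
  (forall y, `|g y| <= C) -> \int[@law P f mf]_y g y = \int[P]_x g (f x).
Proof. by move=> mg gC; rewrite (@Rintegral_distribution _ _ _ _ _ _ _ _ C). Qed.

Lemma ge0_integral_law P f mf (g : T2 -> \bar R) : measurable_fun setT g ->
  (forall y, 0 <= g y)%E -> (\int[@law P f mf]_y g y = \int[P]_x g (f x))%E.
Proof. by move=> mg g0; rewrite ge0_integral_distribution. Qed.

End law_of_function.

Section gauss1.
Context (R : realType).
Notation N := (stdN R).

(** Scaling a standard variable by sqrt v covers the Dirac mass at v = 0, so moments and
    characteristic functions need no case distinction. *)
Lemma gauss1_stdN (v : R) (B : set R) : 0 <= v -> measurable B ->
  (if v == 0 then \d_(0 : R) B else normal_prob 0 (Num.sqrt v) B) =
  N ((fun u => Num.sqrt v * u) @^-1` B).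
Proof.
move=> v0 mB; case: eqP => [->|/eqP vN0].
  rewrite sqrtr0 diracE; have [B0|B0] := boolP ((0 : R) \in B).
    rewrite [X in N X](_ : _ = setT); first by rewrite [RHS]probability_setT.
    by apply/seteqP; split => // u _ /=; rewrite mul0r; move: B0; rewrite inE.
  rewrite [X in N X](_ : _ = set0) ?measure0//.
  by apply/seteqP; split => // u /=; rewrite mul0r; move: B0; rewrite notin_setE.
rewrite normal_prob_stdN//; last by rewrite sqrtr_gt0 lt_neqAle eq_sym vN0.
by under eq_fun do rewrite add0r.
Qed.

Lemma measurable_scale (s : R) : measurable_fun setT (fun u : R => s * u).
Proof. exact: measurable_funM. Qed.

Context d (T : measurableType d) (P : probability T R) (X : T -> R).
Hypothesis mX : measurable_fun setT X.

Section moments.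
Variable v : R.
Hypotheses (v0 : 0 <= v) (gX : gauss1 (pushforward P X) 0 v).

Lemma gauss1_law B : measurable B -> law P mX B = law N (measurable_scale (Num.sqrt v)) B.
Proof. by move=> mB; rewrite [LHS](gX mB) gauss1_stdN. Qed.

Lemma gauss1_cos z th :
  \int[P]_x cos (z * X x + th) = cos th * expR (- (v * z ^+ 2 / 2)).
Proof.
have mc := @measurable_cos_lin R z th.
have c1 (y : R) : `|cos (z * y + th)| <= 1 by exact: norm_cos_le1.
rewrite -(Rintegral_law P mX mc c1).
rewrite [LHS](_ : _ = \int[law N (measurable_scale (Num.sqrt v))]_y cos (z * y + th)); last first.
  rewrite /Rintegral; congr fine; apply: eq_measure_integral => A mA _.
  exact: gauss1_law.
rewrite (Rintegral_law N _ mc c1).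
under eq_Rintegral do rewrite mulrA.
rewrite stdN_cos exprMn sqr_sqrtr//; congr (_ * expR (- _)); ring.
Qed.

Lemma gauss1_sqr : (\int[P]_x ((X x) ^+ 2)%:E = v%:E)%E.
Proof.
have ms : measurable_fun setT (fun y : R => (y ^+ 2)%:E : \bar R).
  by apply/measurable_EFinP; exact: measurable_funX.
have s0 (y : R) : (0 <= (y ^+ 2)%:E :> \bar R)%E by rewrite lee_fin sqr_ge0.
rewrite -(ge0_integral_law P mX ms s0).
rewrite (@eq_measure_integral _ _ _ _ (law N (measurable_scale (Num.sqrt v)))); last first.
  by move=> A mA _; exact: gauss1_law.
rewrite (ge0_integral_law N _ ms s0).
under eq_integral do rewrite exprMn sqr_sqrtr// EFinM.
by rewrite ge0_integralZl// stdN_sqr mule1.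
Qed.

End moments.

Lemma dotv1 (a : vec R 1) (y : R) : dotv a [tuple y] = tnth a ord0 * y.
Proof. by rewrite /dotv big_ord1; congr (_ * _). Qed.

Lemma measurable_tuple1 : measurable_fun setT (fun x => [tuple X x] : vec R 1).
Proof. exact: (@measurable_cons _ _ _ _ X 0 (cst [tuple])). Qed.

(** Uniqueness of the characteristic function on the line, obtained from [cramer_wold] on
    1-tuples. *)
Lemma gauss1_char (v : R) : 0 <= v ->
  (forall z th, \int[P]_x cos (z * X x + th) = cos th * expR (- (v * z ^+ 2 / 2))) ->
  gauss1 (pushforward P X) 0 v.
Proof.
move=> v0 hX B mB; rewrite gauss1_stdN//.
have mt (f : R -> R) : measurable_fun setT f -> measurable_fun setT (fun x => [tuple f x] : vec R 1).
  by move=> mf; exact: (@measurable_cons _ _ _ _ f 0 (cst [tuple])).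
have ms := mt _ (measurable_scale (Num.sqrt v)).
have mA : measurable ((fun x : vec R 1 => tnth x ord0) @^-1` B).
  by rewrite -[X in measurable X]setTI; exact: measurable_tnthR.
have := @cramer_wold R 1 (law P measurable_tuple1) (law N ms) _ _ mA; apply.
move=> a th.
have mc : measurable_fun setT (fun x : vec R 1 => cos (dotv a x + th)).
  apply: (measurableT_comp (@measurable_cosR R)); apply: measurable_funD => //.
  exact: measurable_dotvr.
have c1 (y : vec R 1) : `|cos (dotv a y + th)| <= 1 by exact: norm_cos_le1.
rewrite (Rintegral_law P _ mc c1) (Rintegral_law N _ mc c1).
under eq_Rintegral do rewrite dotv1.
under [RHS]eq_Rintegral do rewrite dotv1 mulrA.
rewrite hX stdN_cos exprMn sqr_sqrtr//; congr (_ * expR (- _)); ring.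
Qed.

Lemma gauss1_atom0 (v r : R) : 0 < v -> gauss1 (pushforward P X) 0 v ->
  P (X @^-1` [set r]) = 0%E.
Proof.
move=> v0 /(_ [set r] (measurable_set1 r)); rewrite gt_eqF// /pushforward => ->.
by rewrite /normal_prob integral_set1.
Qed.

End gauss1.

Section gaussian_vector.
Context (R : realType) (L : nat) (PX : probability (vec R L) R) (S : 'M[R]_L).
Hypotheses (S0 : posdef S) (gX : gaussian_vec0 PX S).

Lemma posdef_ge0 a : 0 <= quadform S a.
Proof.
have [/existsP[i ai]|/existsPn h] := boolP [exists i, tnth a i != 0].
  by apply/ltW/(proj2 S0); exists i.
rewrite /quadform big1// => i _; rewrite big1// => j _.
by move: (h i); rewrite negbK => /eqP ->; rewrite !mul0r.
Qed.

Lemma gaussian_vec_cos a th :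
  \int[PX]_x cos (dotv a x + th) = cos th * expR (- (quadform S a / 2)).
Proof.
have := gauss1_cos (measurable_dotvr a) (posdef_ge0 a) (@gX a) 1 th.
rewrite expr1n mulr1 => <-.
by apply: eq_Rintegral => x _; rewrite mul1r.
Qed.

Lemma gaussian_vec_sqr a : (\int[PX]_x ((dotv a x) ^+ 2)%:E = (quadform S a)%:E)%E.
Proof. exact: (gauss1_sqr (measurable_dotvr a) (posdef_ge0 a) (@gX a)). Qed.

Lemma gaussian_vec_atom0 a r : (exists i, tnth a i != 0) ->
  PX [set x | dotv a x = r] = 0%E.
Proof. by move=> a0; apply: (gauss1_atom0 _ _ (@gX a)); exact: (proj2 S0). Qed.

End gaussian_vector.

Section cholesky_vec.
Context (R : realType).

Let rowv n (a : vec R n) : 'rV[R]_n := \row_i tnth a i.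

Let quadform_row n (S : 'M[R]_n) (a : vec R n) :
  quadform S a = (rowv a *m S *m (rowv a)^T) 0 0.
Proof.
rewrite -mulmxA mxE; apply: eq_bigr => i _; rewrite !mxE mulr_sumr.
by apply: eq_bigr => j _; rewrite !mxE mulrA.
Qed.

Let rowvK n (u : 'rV[R]_n) : rowv [tuple u 0 i | i < n] = u.
Proof. by apply/rowP => i; rewrite mxE tnth_mktuple. Qed.

Lemma cholesky_vec n (S : 'M[R]_n) : S^T = S -> (forall a, 0 <= quadform S a) ->
  exists F : 'M[R]_n, F *m F^T = S /\
   ((forall a : vec R n, (exists i, tnth a i != 0) -> 0 < quadform S a) ->
      F \in unitmx /\ lebint_scaled F).
Proof.
move=> St S0; have [|F [FE FP]] := @cholesky R n S St.
  by move=> u; rewrite -(rowvK u) -quadform_row.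
exists F; split => // Sp; apply: FP => u u0.
rewrite -(rowvK u) -quadform_row; apply: Sp.
have /rV0Pn[i ui] := u0; exists i; by rewrite tnth_mktuple.
Qed.

End cholesky_vec.

(** * Second moments and Gaussian regression *)

Section second_moments.
Context d (T : measurableType d) (R : realType) (P : probability T R).

Definition sq_integrable (f : T -> R) :=
  measurable_fun setT f /\ P.-integrable setT (EFin \o (fun x => f x ^+ 2)).

Lemma sq_integrableP (f : T -> R) (c : R) : measurable_fun setT f ->
  (\int[P]_x (f x ^+ 2)%:E <= c%:E)%E -> sq_integrable f.
Proof.
move=> mf fc; split => //; apply/integrableP; split.
  by apply/measurable_EFinP; exact: measurable_funX.
under eq_integral do rewrite /= ger0_norm ?sqr_ge0//.
by rewrite (le_lt_trans fc)// ltry.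
Qed.

Lemma integrable_mul f g : sq_integrable f -> sq_integrable g ->
  P.-integrable setT (EFin \o (fun x => f x * g x)).
Proof.
move=> [mf i2f] [mg i2g].
have i2 : P.-integrable setT (EFin \o (fun x => f x ^+ 2 + g x ^+ 2)).
  exact: (integrableD measurableT i2f i2g).
apply: le_integrable i2 => //; first by apply/measurable_EFinP; exact: measurable_funM.
move=> x _; rewrite /= lee_fin [leRHS]ger0_norm ?addr_ge0 ?sqr_ge0//.
rewrite ler_norml; apply/andP; split.
  have := sqr_ge0 (f x + g x); rewrite sqrrD; have := sqr_ge0 (f x); have := sqr_ge0 (g x); lra.
have := sqr_ge0 (f x - g x); rewrite sqrrB; have := sqr_ge0 (f x); have := sqr_ge0 (g x); lra.
Qed.

Lemma Rintegral_sum (I : Type) (r : seq I) (F : I -> T -> R) :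
  (forall i, P.-integrable setT (EFin \o F i)) ->
  P.-integrable setT (EFin \o (fun x => \sum_(i <- r) F i x)) /\
  \int[P]_x (\sum_(i <- r) F i x) = \sum_(i <- r) \int[P]_x F i x.
Proof.
move=> iF; elim: r => [|i r [ir IH]].
  under eq_fun do rewrite big_nil.
  rewrite big_nil Rintegral_prob_cst; split => //.
  by apply: (@integrable_bounded _ _ _ P (fun=> 0) 0) => // x; rewrite normr0.
have -> : (fun x => \sum_(j <- i :: r) F j x) = (fun x => F i x + \sum_(j <- r) F j x).
  by apply/funext => x; rewrite big_cons.
split; first exact: (integrableD measurableT (iF i) ir).
by rewrite (RintegralD measurableT (iF i) ir) IH big_cons.
Qed.

(** The right side has the shape of [dotv a (mulv M b)] for the matrix M of mixed moments. *)
Lemma Rintegral_bilinear n m (f : 'I_n -> T -> R) (g : 'I_m -> T -> R) (a : 'I_n -> R) (b : 'I_m -> R) :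
  (forall i, sq_integrable (f i)) -> (forall j, sq_integrable (g j)) ->
  P.-integrable setT (EFin \o (fun x => (\sum_i a i * f i x) * (\sum_j b j * g j x))) /\
  \int[P]_x ((\sum_i a i * f i x) * (\sum_j b j * g j x)) =
  \sum_i a i * \sum_j (\int[P]_x (f i x * g j x)) * b j.
Proof.
move=> fL gL.
have i1 i j : P.-integrable setT (EFin \o (fun x => a i * b j * (f i x * g j x))).
  exact: (integrableZl measurableT (a i * b j) (integrable_mul (fL i) (gL j))).
have h2 i := @Rintegral_sum _ (index_enum 'I_m) _ (i1 i).
have h3 := @Rintegral_sum _ (index_enum 'I_n) _ (fun i => (h2 i).1).
have -> : (fun x => (\sum_i a i * f i x) * (\sum_j b j * g j x)) =
    (fun x => \sum_i \sum_j a i * b j * (f i x * g j x)).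
  apply/funext => x; rewrite mulr_suml; apply: eq_bigr => i _; rewrite mulr_sumr.
  by apply: eq_bigr => j _; ring.
split; first exact: h3.1.
rewrite h3.2; apply: eq_bigr => i _; rewrite (h2 i).2 mulr_sumr; apply: eq_bigr => j _.
by rewrite (RintegralZl _ measurableT (integrable_mul (fL i) (gL j))); ring.
Qed.

(** [q] has the shape of a log-ratio of Gaussian densities. Its mean involves the law only through
    second moments, so two laws with the same second moments give the same value. *)
Lemma integral_quadratic n (c : R) (h h' : 'I_n -> T -> R) (v v' : 'I_n -> R) :
  (forall k, measurable_fun setT (h k)) -> (forall k, measurable_fun setT (h' k)) ->
  (forall k, \int[P]_x (h k x ^+ 2)%:E = (v k)%:E)%E ->
  (forall k, \int[P]_x (h' k x ^+ 2)%:E = (v' k)%:E)%E ->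
  let q x := c - 2^-1 * (\sum_k h k x ^+ 2) + 2^-1 * (\sum_k h' k x ^+ 2) in
  P.-integrable setT (EFin \o q) /\
  (\int[P]_x (q x)%:E = (c - 2^-1 * (\sum_k v k) + 2^-1 * (\sum_k v' k))%:E)%E.
Proof.
move=> mh mh' hv hv' q.
have ih k : P.-integrable setT (EFin \o (fun x => h k x ^+ 2)).
  by have [] : sq_integrable (h k) by apply: (@sq_integrableP _ (v k)) => //; rewrite hv.
have ih' k : P.-integrable setT (EFin \o (fun x => h' k x ^+ 2)).
  by have [] : sq_integrable (h' k) by apply: (@sq_integrableP _ (v' k)) => //; rewrite hv'.
have [s1 e1] := @Rintegral_sum _ (index_enum 'I_n) _ ih.
have [s2 e2] := @Rintegral_sum _ (index_enum 'I_n) _ ih'.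
have ic : P.-integrable setT (EFin \o (fun=> c)).
  by apply: (@integrable_bounded _ _ _ P (fun=> c) `|c|).
have z1 := integrableZl measurableT 2^-1 s1.
have z2 := integrableZl measurableT 2^-1 s2.
have d1 : P.-integrable setT (EFin \o (fun x => c - 2^-1 * (\sum_k h k x ^+ 2))).
  exact: (integrableB measurableT ic z1).
have d2 : P.-integrable setT (EFin \o q) by exact: (integrableD measurableT d1 z2).
split => //.
rewrite -[LHS]fineK; last exact: integrable_fin_num.
congr EFin; rewrite -[LHS]/(\int[P]_x q x) /q.
rewrite (RintegralD measurableT d1 z2) (RintegralB measurableT ic z1).
rewrite (RintegralZl _ measurableT s1) (RintegralZl _ measurableT s2) e1 e2 Rintegral_prob_cst.
congr (_ - _ * _ + _ * _); apply: eq_bigr => k _.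
  by rewrite /Rintegral hv.
by rewrite /Rintegral hv'.
Qed.

End second_moments.

Section regression.
Context (R : realType) (L : nat) (Sx C K : 'M[R]_L).
Notation V := (vec R L).

(** Second moment of a.X + b.Y when [Sx], [C], [K] are the blocks E[X X^T], E[X Y^T], E[Y Y^T]. *)
Definition vform (a b : V) : R := quadform Sx a + 2 * dotv a (mulv C b) + quadform K b.

Hypotheses (Kt : K^T = K) (v0 : forall a b, 0 <= vform a b).

Lemma quadformZ (S : 'M[R]_L) t a : quadform S (scalev t a) = t ^+ 2 * quadform S a.
Proof.
rewrite /quadform mulr_sumr; apply: eq_bigr => i _; rewrite mulr_sumr; apply: eq_bigr => j _.
by rewrite !tnth_mktuple; ring.
Qed.

Lemma linear_part_eq0 (p r : R) : (forall t, 0 <= t ^+ 2 * p + 2 * t * r) -> r = 0.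
Proof.
move=> h.
have p0 : 0 <= p by have := h 1; have := h (-1); rewrite !expr2; lra.
have p1 : 0 < p + 1 by lra.
(* Dividing by p + 1 avoids a separate case p = 0; the value is then a negative multiple of r^2. *)
have := h (- r / (p + 1)).
have -> : (- r / (p + 1)) ^+ 2 * p + 2 * (- r / (p + 1)) * r = - (r ^+ 2 * ((p + 2) / (p + 1) ^+ 2)).
  by field; rewrite gt_eqF.
rewrite oppr_ge0 => h1; apply/eqP; rewrite -sqrf_eq0 eq_le sqr_ge0 andbT.
have k0 : 0 < (p + 2) / (p + 1) ^+ 2 by rewrite divr_gt0 ?exprn_gt0//; lra.
by rewrite -(pmulr_lle0 _ k0).
Qed.

(** If K u = 0 then C u = 0: along (t a, u) the nonnegative form has no constant term, so its linear
    part a.(C u) vanishes. The kernel inclusion gives the row space inclusion even for singular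
    [K]. *)
Lemma regression_exists : exists A : 'M[R]_L, A *m K = C.
Proof.
suff /submxP[A ->] : (C <= K)%MS by exists A.
rewrite submxE; apply/eqP; set W := cokermx K.
have KW : K *m W = 0 by exact: mulmx_coker.
apply/matrixP => i j; rewrite [RHS]mxE.
pose u : V := [tuple W k j | k < L].
have Ku : quadform K u = 0.
  rewrite quadform_dotv /dotv big1// => k _; rewrite tnth_mulv.
  have := congr1 (fun M : 'M[R]_L => M k j) KW; rewrite !mxE => h.
  by under eq_bigr do rewrite tnth_mktuple; rewrite h mulr0.
have -> : (C *m W) i j = dotv (unitv i) (mulv C u).
  rewrite dotv_unit tnth_mulv mxE; apply: eq_bigr => k _; by rewrite tnth_mktuple.
apply: (@linear_part_eq0 (quadform Sx (unitv i))) => t.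
by have := v0 (scalev t (unitv i)) u; rewrite /vform Ku quadformZ dotvZl; lra.
Qed.

Variable A : 'M[R]_L.
Hypothesis AK : A *m K = C.

(** The second-moment matrix of the regression residual X - A Y, a Schur complement. *)
Definition residual_cov := Sx - A *m K *m A^T.

Lemma quadformB (S S' : 'M[R]_L) a : quadform (S - S') a = quadform S a - quadform S' a.
Proof.
rewrite /quadform -sumrB; apply: eq_bigr => i _; rewrite -sumrB; apply: eq_bigr => j _.
by rewrite !mxE; ring.
Qed.

Lemma quadform_conj (M S : 'M[R]_L) a : quadform (M *m S *m M^T) a = quadform S (mulv M^T a).
Proof. by rewrite !quadform_dotv !mulvM dotv_mulv. Qed.

(** a.(X - A Y) is the linear form with b = - A^T a, so the sign of the residual form is controlled
    by that of [vform]. *)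
Lemma quadform_residual a : quadform residual_cov a = vform a (scalev (-1) (mulv A^T a)).
Proof.
rewrite /residual_cov quadformB quadform_conj /vform quadformZ -AK mulvM.
rewrite mulvZ dotv_mulv dotvC dotvZl dotvC -quadform_dotv; ring.
Qed.

Lemma residual_sym : Sx^T = Sx -> residual_cov^T = residual_cov.
Proof.
by move=> St; rewrite /residual_cov linearB/= St !trmx_mul trmxK Kt mulmxA.
Qed.

Lemma quadformD_dotv (S : 'M[R]_L) a b : S^T = S ->
  quadform S (vadd a b) = quadform S a + 2 * dotv a (mulv S b) + quadform S b.
Proof.
move=> St; rewrite !quadform_dotv mulvDr !dotvDl !dotvDr.
have -> : dotv b (mulv S a) = dotv a (mulv S b) by rewrite dotv_mulv St dotvC.
ring.
Qed.

(** The left side is the variance of a.X + b.Y when Y = FK g and X = A Y + F g' with g, g'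
    independent standard vectors. *)
Lemma vform_gram (FK F : 'M[R]_L) a b : FK *m FK^T = K -> F *m F^T = residual_cov ->
  dotv (mulv FK^T (vadd (mulv A^T a) b)) (mulv FK^T (vadd (mulv A^T a) b)) +
  dotv (mulv F^T a) (mulv F^T a) = vform a b.
Proof.
move=> FKE FE; rewrite -!quadform_gram FKE FE (quadformD_dotv _ _ Kt).
rewrite /residual_cov quadformB quadform_conj /vform -AK mulvM (dotv_mulv a A); ring.
Qed.

End regression.

(** * The joint Gaussian law built by regression of X on Y *)

Section joint_law.
Context (R : realType) (L : nat) (A FK F : 'M[R]_L).
Notation V := (vec R L).
Notation G := (@gaussv R L).

(** Y is drawn first and X is built from it, so that X given Y has a density as soon as [F] is
    invertible, however degenerate Y may be. *)
Definition joint_map (g : V * V) : V * V :=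
  (vadd (mulv A (mulv FK g.1)) (mulv F g.2), mulv FK g.1).

Lemma measurable_joint_map : measurable_fun setT joint_map.
Proof.
apply: measurable_fun_pair => /=.
  apply: measurable_vadd; last exact: (measurableT_comp (measurable_mulv F)).
  apply: (measurableT_comp (measurable_mulv A)).
  exact: (measurableT_comp (measurable_mulv FK)).
exact: (measurableT_comp (measurable_mulv FK)).
Qed.

Definition joint_law : probability (V * V)%type R := law (G \x G)%E measurable_joint_map.

Definition lform (a b : V) (z : V * V) : R := dotv a z.1 + dotv b z.2.

Lemma measurable_lform a b : measurable_fun setT (lform a b).
Proof.
by apply: measurable_funD; apply: (measurableT_comp (measurable_dotvr _)).
Qed.

Lemma joint_law_cos a b th : \int[joint_law]_z cos (lform a b z + th) =
  cos th * expR (- ((dotv (mulv FK^T (vadd (mulv A^T a) b)) (mulv FK^T (vadd (mulv A^T a) b)) +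
    dotv (mulv F^T a) (mulv F^T a)) / 2)).
Proof.
have mc : measurable_fun setT (fun z : V * V => cos (lform a b z + th)).
  apply: (measurableT_comp (@measurable_cosR R)); apply: measurable_funD => //.
  exact: measurable_lform.
have c1 (y : V * V) : `|cos (lform a b y + th)| <= 1 by exact: norm_cos_le1.
rewrite (Rintegral_law _ _ mc c1).
set u := mulv FK^T _; set w := mulv F^T a.
have e (g : V * V) : cos (lform a b (joint_map g) + th) = cos (dotv w g.2 + (dotv u g.1 + th)).
  congr cos; rewrite /lform /joint_map/= dotvDr dotv_mulv -/w.
  by rewrite /u !dotv_mulv -dotv_mulv dotv_mulv mulvDr dotvDl; ring.
under eq_Rintegral do rewrite e.
have mc2 : measurable_fun setT (fun g : V * V => cos (dotv w g.2 + (dotv u g.1 + th))).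
  apply: (measurableT_comp (@measurable_cosR R)); apply: measurable_funD.
    exact: (measurableT_comp (measurable_dotvr w)).
  by apply: measurable_funD => //; exact: (measurableT_comp (measurable_dotvr u)).
rewrite (@Rintegral_prod _ _ _ _ _ G G _ 1 mc2); last by move=> z; exact: norm_cos_le1.
under eq_Rintegral do rewrite /= gaussv_cos.
rewrite RintegralZr//; last first.
  apply: (@integrable_bounded _ _ _ G _ 1); last by move=> z; exact: norm_cos_le1.
  apply: (measurableT_comp (@measurable_cosR R)); apply: measurable_funD => //.
  exact: measurable_dotvr.
rewrite gaussv_cos -mulrA -expRD; congr (_ * expR _); ring.
Qed.

Definition linear_law (M : 'M[R]_L) : probability V R := law G (measurable_mulv M).

(** Only [FK] enters the second marginal; laws with different [A] and [F] share it, as the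
    Wasserstein bound requires. *)
Lemma joint_law_snd B : measurable B -> joint_law (snd @^-1` B) = linear_law FK B.
Proof.
move=> mB; rewrite lawE /linear_law lawE.
transitivity ((G \x G)%E ((mulv FK @^-1` B) `*` setT)).
  by congr ((G \x G)%E _); apply/seteqP; split => // -[x y] /= [].
have mA : measurable (mulv FK @^-1` B).
  by rewrite -[X in measurable X]setTI; exact: measurable_mulv.
apply: etrans; first by apply: product_measure1E.
by rewrite [X in (_ * X)%E](_ : _ = 1%E) ?mule1//; exact: probability_setT.
Qed.

(** Disintegration along Y: given y, the first component is Gaussian with mean A y and covariance F
    F^T. *)
Lemma ge0_integral_joint_law (f : V * V -> \bar R) : measurable_fun setT f ->
  (forall z, 0 <= f z)%E ->
  (\int[joint_law]_z f z =
   \int[linear_law FK]_y \int[G]_g f (vadd (mulv A y) (mulv F g), y))%E.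
Proof.
move=> mf f0; rewrite (ge0_integral_law _ _ mf f0).
have mfg : measurable_fun setT (fun p : V * V => f (vadd (mulv A p.1) (mulv F p.2), p.1)).
  apply: (measurableT_comp mf); apply: measurable_fun_pair => //=.
  by apply: measurable_vadd; apply: (measurableT_comp (measurable_mulv _)).
rewrite ge0_integral_law; last 2 first.
- exact: (measurable_fun_fubini_tonelli_F _ mfg).
- by move=> y; apply: integral_ge0.
rewrite (fubini_tonelli1 (fun g => f (joint_map g)))//.
by apply: (measurableT_comp mf); exact: measurable_joint_map.
Qed.

End joint_law.

(** * Density of one Gaussian law relative to another *)

Section gaussian_density.
Context (R : realType) (L : nat).
Notation V := (vec R L).
Notation G := (@gaussv R L).
Variables (PX : probability V R) (A0 F : 'M[R]_L).
Hypotheses (PXE : forall B, measurable B -> PX B = linear_law A0 B)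
  (A0u : A0 \in unitmx) (A0s : lebint_scaled A0) (Fu : F \in unitmx) (Fs : lebint_scaled F).

Definition rowvec (M : 'M[R]_L) (k : 'I_L) : V := [tuple M k j | j < L].

Lemma dotv_rowvec M k x : dotv (rowvec M k) x = tnth (mulv M x) k.
Proof. by rewrite tnth_mulv; apply: eq_bigr => j _; rewrite tnth_mktuple. Qed.

Lemma mulKv (M : 'M[R]_L) (x : V) : M \in unitmx -> mulv (invmx M) (mulv M x) = x.
Proof. by move=> Mu; rewrite -mulvM mulVmx// mulv1. Qed.

Definition sqnorm (x : V) : R := \sum_k tnth x k ^+ 2.

Lemma sqnorm_dotv x : sqnorm x = dotv x x.
Proof. by apply: eq_bigr => k _; rewrite expr2. Qed.

Lemma measurable_sqnorm_comp d (T : measurableType d) (f : T -> V) :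
  measurable_fun setT f -> measurable_fun setT (fun t => sqnorm (f t)).
Proof.
move=> mf; rewrite (_ : (fun t => _) = fun t => dotv (f t) (f t)); last first.
  by apply/funext => t; rewrite sqnorm_dotv.
exact: measurable_dotv.
Qed.

Lemma gaussian_density : exists c : R, forall (m : V) (f : V -> \bar R),
  measurable_fun setT f -> (forall x, 0 <= f x)%E ->
  (\int[G]_z f (vadd m (mulv F z)) =
   \int[PX]_x (f x * (expR (c - 2^-1 * sqnorm (mulv (invmx F) (vadd (scalev (-1) m) x))
      + 2^-1 * sqnorm (mulv (invmx A0) x)))%:E))%E.
Proof.
have [cF cF0 hF] := Fs; have [cA cA0 hA] := A0s.
exists (ln (cF / cA)) => m f mf f0.
pose h x : \bar R := (f x * (expR (- (sqnorm (mulv (invmx F) (vadd (scalev (-1) m) x)) / 2)))%:E)%E.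
have ms1 : measurable_fun setT (fun x => sqnorm (mulv (invmx F) (vadd (scalev (-1) m) x))).
  apply: measurable_sqnorm_comp; apply: (measurableT_comp (measurable_mulv _)).
  exact: measurable_vadd.
have ms2 : measurable_fun setT (fun x => sqnorm (mulv (invmx A0) x)).
  by apply: measurable_sqnorm_comp; exact: measurable_mulv.
have mh : measurable_fun setT h.
  apply: emeasurable_funM => //; apply/measurable_EFinP; apply: measurableT_comp => //.
  by apply: measurableT_comp => //; exact: measurable_funM.
have h0 x : (0 <= h x)%E by rewrite mule_ge0// lee_fin expR_ge0.
have -> : (\int[G]_z f (vadd m (mulv F z)) = cF%:E * lebint h)%E.
  rewrite gaussv_lebint -(hF m h mh h0); congr lebint; apply/funext => z.
  by rewrite /h vaddK mulKv// sqnorm_dotv.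
set H := (X in (\int[PX]_x X x)%E).
have mH : measurable_fun setT H.
  apply: emeasurable_funM => //; apply/measurable_EFinP; apply: measurableT_comp => //.
  apply: measurable_funD; last exact: measurable_funM.
  by apply: measurable_funB => //; exact: measurable_funM.
have H0 x : (0 <= H x)%E by rewrite mule_ge0// lee_fin expR_ge0.
rewrite (@eq_measure_integral _ _ _ _ (linear_law A0)); last by move=> B mB _; exact: PXE.
rewrite (ge0_integral_law _ _ mH H0) gaussv_lebint.
have -> : (fun z => H (mulv A0 z) * (expR (- (dotv z z / 2)))%:E)%E =
   (fun z => (fun x => (cF / cA)%:E * h x)%E (vadd zerov (mulv A0 z))).
  apply/funext => z.
  have -> : vadd zerov (mulv A0 z) = mulv A0 z.
    by apply: eq_from_tnth => i; rewrite tnth_vadd tnth_mktuple add0r.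
  rewrite /H /h mulKv// -sqnorm_dotv -muleA -EFinM [RHS]muleCA -EFinM; congr (_ * _%:E)%E.
  rewrite -expRD -[X in _ = X * _](@lnK _ (cF / cA)) ?posrE ?divr_gt0// -expRD.
  by congr expR; field.
rewrite (hA zerov (fun x => ((cF / cA)%:E * h x)%E)); last 2 first.
- by apply: emeasurable_funM.
- by move=> x; rewrite mule_ge0// lee_fin divr_ge0// ltW.
rewrite (lebintZl _ mh h0); last by rewrite divr_ge0// ltW.
by rewrite muleA -EFinM mulrCA divff ?mulr1// gt_eqF.
Qed.

End gaussian_density.

(** * Gaussian law with prescribed second moments *)

Section second_moment_matching.
Context (R : realType) (L : nat) (SigmaX : 'M[R]_L).
Notation V := (vec R L).
Notation G := (@gaussv R L).
Variable (PX : probability V R).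
Hypotheses (S0 : posdef SigmaX) (gX : gaussian_vec0 PX SigmaX).

Definition has_fst (pi : probability (V * V)%type R) :=
  forall A, measurable A -> distribution pi (@pfst _ _ V V) A = PX A.

Lemma ge0_integral_fst pi (f : V -> \bar R) : has_fst pi -> measurable_fun setT f ->
  (forall x, 0 <= f x)%E -> (\int[pi]_z f z.1 = \int[PX]_x f x)%E.
Proof.
move=> h mf f0; rewrite -(@ge0_integral_distribution _ _ _ _ _ pi (@pfst _ _ V V) f mf f0).
by apply: eq_measure_integral => A mA _; exact: h.
Qed.

Section moments.
Variables (pi : probability (V * V)%type R) (D : R).
Hypotheses (h1 : has_fst pi) (hD : (\int[pi]_z (sqdist z.1 z.2)%:E <= D%:E)%E).

Let X i (z : V * V) : R := tnth z.1 i.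
Let Y i (z : V * V) : R := tnth z.2 i.

Lemma measurable_X i : measurable_fun setT (X i).
Proof. exact: (measurableT_comp (measurable_tnthR i)). Qed.

Lemma measurable_Y i : measurable_fun setT (Y i).
Proof. exact: (measurableT_comp (measurable_tnthR i)). Qed.

Lemma integral_fst_sqr a : (\int[pi]_z (dotv a z.1 ^+ 2)%:E = (quadform SigmaX a)%:E)%E.
Proof.
rewrite -(gaussian_vec_sqr S0 gX a).
apply: (@ge0_integral_fst pi (fun x => (dotv a x ^+ 2)%:E)) => //.
  by apply/measurable_EFinP; apply: measurable_funX; exact: measurable_dotvr.
by move=> x; rewrite lee_fin sqr_ge0.
Qed.

Lemma sq_integrable_X i : sq_integrable pi (X i).
Proof.
apply: (@sq_integrableP _ _ _ _ _ (quadform SigmaX (unitv i))); first exact: measurable_X.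
by rewrite -integral_fst_sqr; under [leRHS]eq_integral do rewrite dotv_unit.
Qed.

Lemma measurable_sqdist : measurable_fun setT (fun z : V * V => sqdist z.1 z.2).
Proof.
apply: measurable_sum => i; apply: measurable_funX.
by apply: measurable_funB; [exact: measurable_X|exact: measurable_Y].
Qed.

Lemma sqdist_ge0 (x y : V) : 0 <= sqdist x y.
Proof. by apply: sumr_ge0 => i _; exact: sqr_ge0. Qed.

(** Finite distortion and the second moments of X bound those of Y, through y^2 <= 2 (x^2 + (x -
    y)^2). *)
Lemma sq_integrable_Y i : sq_integrable pi (Y i).
Proof.
have [mX iX] := sq_integrable_X i; split; first exact: measurable_Y.
have id : pi.-integrable setT (EFin \o (fun z => sqdist z.1 z.2)).
  apply/integrableP; split; first by apply/measurable_EFinP; exact: measurable_sqdist.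
  under eq_integral do rewrite /= ger0_norm ?sqdist_ge0//.
  by rewrite (le_lt_trans hD)// ltry.
have i2 : pi.-integrable setT (EFin \o (fun z => 2 * (X i z ^+ 2 + sqdist z.1 z.2))).
  exact: (integrableZl measurableT 2 (integrableD measurableT iX id)).
apply: le_integrable i2 => //.
  by apply/measurable_EFinP; apply: measurable_funX; exact: measurable_Y.
move=> z _; rewrite /= lee_fin ger0_norm ?sqr_ge0// ger0_norm; last first.
  by rewrite mulr_ge0// addr_ge0 ?sqr_ge0 ?sqdist_ge0.
have : (X i z - Y i z) ^+ 2 <= sqdist z.1 z.2.
  rewrite /sqdist (bigD1 i)//= lerDl; apply: sumr_ge0 => j _; exact: sqr_ge0.
(* 2 x^2 + 2 (x - y)^2 - y^2 is the square of 2 x - y. *)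
have := sqr_ge0 (2 * X i z - Y i z); rewrite !sqrrB exprMn; nra.
Qed.

Definition momXX : 'M[R]_L := \matrix_(i, j) \int[pi]_z (X i z * X j z).
Definition momXY : 'M[R]_L := \matrix_(i, j) \int[pi]_z (X i z * Y j z).
Definition momYY : 'M[R]_L := \matrix_(i, j) \int[pi]_z (Y i z * Y j z).

Lemma momXX_sym : momXX^T = momXX.
Proof.
by apply/matrixP => i j; rewrite !mxE; apply: eq_Rintegral => z _; rewrite mulrC.
Qed.

Lemma momYY_sym : momYY^T = momYY.
Proof.
by apply/matrixP => i j; rewrite !mxE; apply: eq_Rintegral => z _; rewrite mulrC.
Qed.

Notation v := (vform momXX momXY momYY).

Lemma lform_sqr a b : (\int[pi]_z (lform a b z ^+ 2)%:E = (v a b)%:E)%E.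
Proof.
have [ixx exx] := @Rintegral_bilinear _ _ _ pi _ _ X X (tnth a) (tnth a) sq_integrable_X sq_integrable_X.
have [ixy exy] := @Rintegral_bilinear _ _ _ pi _ _ X Y (tnth a) (tnth b) sq_integrable_X sq_integrable_Y.
have [iyy eyy] := @Rintegral_bilinear _ _ _ pi _ _ Y Y (tnth b) (tnth b) sq_integrable_Y sq_integrable_Y.
have ixy2 := integrableZl measurableT 2 ixy.
have i1 : pi.-integrable setT (EFin \o (fun z => (\sum_i tnth a i * X i z) * (\sum_j tnth a j * X j z) +
    2 * ((\sum_i tnth a i * X i z) * (\sum_j tnth b j * Y j z)))).
  exact: (integrableD measurableT ixx ixy2).
have i2 : pi.-integrable setT (EFin \o (fun z => (\sum_i tnth a i * X i z) * (\sum_j tnth a j * X j z) +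
    2 * ((\sum_i tnth a i * X i z) * (\sum_j tnth b j * Y j z)) + (\sum_i tnth b i * Y i z) * (\sum_j tnth b j * Y j z))).
  exact: (integrableD measurableT i1 iyy).
have E : (fun z => lform a b z ^+ 2) = (fun z => (\sum_i tnth a i * X i z) * (\sum_j tnth a j * X j z) +
    2 * ((\sum_i tnth a i * X i z) * (\sum_j tnth b j * Y j z)) + (\sum_i tnth b i * Y i z) * (\sum_j tnth b j * Y j z)).
  by apply/funext => z; rewrite /lform /dotv /X /Y; ring.
rewrite -[LHS]fineK; last by apply: integrable_fin_num => //; move: i2; rewrite -E.
congr EFin; rewrite -[LHS]/(\int[pi]_z (lform a b z ^+ 2)) E.
rewrite (RintegralD measurableT i1 iyy) (RintegralD measurableT ixx ixy2) (RintegralZl _ measurableT ixy).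
rewrite exx exy eyy /vform !quadform_dotv /dotv; congr (_ + 2 * _ + _); apply: eq_bigr => i _;
  rewrite tnth_mulv; congr (_ * _); by apply: eq_bigr => j _; rewrite mxE.
Qed.

Lemma mom_vform_ge0 a b : 0 <= v a b.
Proof. by rewrite -lee_fin -lform_sqr; apply: integral_ge0 => z _; rewrite lee_fin sqr_ge0. Qed.

Lemma lform_fst (a : V) (z : V * V) : lform a zerov z = dotv a z.1.
Proof. by rewrite /lform dotv0l addr0. Qed.

Lemma lform_snd (b : V) (z : V * V) : lform zerov b z = dotv b z.2.
Proof. by rewrite /lform dotv0l add0r. Qed.

Lemma mom_vform_fst a : v a zerov = quadform SigmaX a.
Proof.
apply: EFin_inj; rewrite -lform_sqr -integral_fst_sqr.
by apply: eq_integral => z _; rewrite lform_fst.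
Qed.

Lemma mom_vform_snd b : v zerov b = quadform momYY b.
Proof.
rewrite /vform dotv0l mulr0 addr0 (_ : quadform momXX zerov = 0) ?add0r//.
by rewrite quadform_dotv dotv0l.
Qed.

Lemma momYY_ge0 b : 0 <= quadform momYY b.
Proof. by rewrite -mom_vform_snd mom_vform_ge0. Qed.

(* The law of (A Y + F g, Y), where Y and g are independent centred Gaussian
   vectors: its covariance is that of [pi], and Cramer-Wold does the rest. *)
Lemma gaussianize FK : FK *m FK^T = momYY -> exists A F, let pi' := joint_law A FK F in
  [/\ A *m momYY = momXY, F *m F^T = residual_cov momXX momYY A,
   (forall a : V, (exists i, tnth a i != 0) -> 0 < quadform (residual_cov momXX momYY A) a) ->
      F \in unitmx /\ lebint_scaled F,
   has_fst pi' &
   forall a b, gauss1 (pushforward pi' (lform a b)) 0 (v a b)].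
Proof.
move=> FKE; have [A AK] := regression_exists mom_vform_ge0.
have [|a|F [FE FP]] := @cholesky_vec R L (residual_cov momXX momYY A).
- by apply: residual_sym; [exact: momYY_sym|exact: momXX_sym].
- by rewrite (quadform_residual _ AK) mom_vform_ge0.
have pcos a b th : \int[joint_law A FK F]_z cos (lform a b z + th) = cos th * expR (- (v a b / 2)).
  by rewrite joint_law_cos (vform_gram momYY_sym AK _ _ FKE FE).
exists A, F => pi'; split; [exact: AK|exact: FE|exact: FP| |].
- move=> B mB.
  apply: (@cramer_wold R L (distribution pi' (@pfst _ _ V V)) PX) => // a th.
  have mc : measurable_fun setT (fun x : V => cos (dotv a x + th)).
    apply: (measurableT_comp (@measurable_cosR R)); apply: measurable_funD => //.
    exact: measurable_dotvr.
  rewrite (@Rintegral_distribution _ _ _ _ _ _ _ _ 1 mc); last by move=> y; exact: norm_cos_le1.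
  rewrite (gaussian_vec_cos S0 gX) -mom_vform_fst -pcos.
  by apply: eq_Rintegral => z _; rewrite lform_fst.
- move=> a b; apply: gauss1_char; [exact: measurable_lform|exact: mom_vform_ge0|].
  move=> z th.
  rewrite (@eq_Rintegral _ _ _ _ _ (fun x => cos (lform (scalev z a) (scalev z b) x + th))); last first.
    by move=> x _; rewrite /lform !dotvZl mulrDr.
  rewrite pcos; congr (_ * expR (- (_ / 2))).
  rewrite /vform !quadformZ dotvZl dotvC mulvZ.
  by rewrite dotvZl (dotvC _ a); ring.
Qed.

End moments.

(** The squared distance is the sum of the squares of the linear forms x_i - y_i. *)
Lemma integral_sqdist (Q : probability (V * V)%type R) (w : V -> V -> R) :
  (forall a b, \int[Q]_z (lform a b z ^+ 2)%:E = (w a b)%:E)%E ->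
  (\int[Q]_z (sqdist z.1 z.2)%:E = (\sum_i w (unitv i) (scalev (-1) (unitv i)))%:E)%E.
Proof.
move=> hw.
have E (z : V * V) : (sqdist z.1 z.2)%:E = (\sum_i (lform (unitv i) (scalev (-1) (unitv i)) z ^+ 2)%:E)%E.
  rewrite sumEFin; congr EFin; apply: eq_bigr => i _.
  by rewrite /lform dotvZl !dotv_unit mulN1r.
under eq_integral do rewrite E.
rewrite ge0_integral_sum//; last 2 first.
- by move=> i; apply/measurable_EFinP; apply: measurable_funX; exact: measurable_lform.
- by move=> i z _; rewrite lee_fin sqr_ge0.
by rewrite -sumEFin; apply: eq_bigr => i _; rewrite hw.
Qed.

End second_moment_matching.

(** * Optimality of the Gaussian law *)

Section optimality.
Context (R : realType) (L : nat) (SigmaX : 'M[R]_L).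
Notation V := (vec R L).
Notation G := (@gaussv R L).
Variable (PX : probability V R).
Hypotheses (S0 : posdef SigmaX) (gX : gaussian_vec0 PX SigmaX).

(** [PX] is given only through its projections; this presents it as the law of A0 g, the form that
    [gaussian_density] works with. *)
Lemma gaussian_vec_linear_law : exists A0 : 'M[R]_L,
  [/\ A0 \in unitmx, lebint_scaled A0 & forall B, measurable B -> PX B = linear_law A0 B].
Proof.
have [A0 [AE AP]] := cholesky_vec (proj1 S0) (posdef_ge0 S0).
have [A0u A0s] := AP (proj2 S0).
exists A0; split => //; apply: cramer_wold => a th.
have mc : measurable_fun setT (fun x : V => cos (dotv a x + th)).
  apply: (measurableT_comp (@measurable_cosR R)); apply: measurable_funD => //.
  exact: measurable_dotvr.
rewrite (@Rintegral_law _ _ _ _ _ _ _ _ _ 1 mc); last by move=> y; exact: norm_cos_le1.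
under [RHS]eq_Rintegral do rewrite dotv_mulv.
by rewrite gaussv_cos (gaussian_vec_cos S0 gX) -quadform_gram AE.
Qed.

Lemma null_setC_contra d (T : measurableType d) (P : probability T R) (H : set T) :
  measurable H -> P H = 0%E -> P (~` H) = 0%E -> False.
Proof.
move=> mH H0; rewrite (probability_setC P mH) H0 sube0 => /eqP.
by rewrite onee_eq0.
Qed.

Lemma KLdiv_dominates d (T : measurableType d) (P Q : probability T R) :
  KLdiv P Q != +oo%E -> P `<< Q.
Proof. by rewrite /KLdiv; case: pselect. Qed.

Lemma ge0_integral_prod_fst (pi : probability (V * V)%type R) (f : V * V -> \bar R) :
  has_fst PX pi -> measurable_fun setT f -> (forall z, 0 <= f z)%E ->
  (\int[distribution pi (@pfst _ _ V V) \x distribution pi (@psnd _ _ V V)]_z f z =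
   \int[distribution pi (@psnd _ _ V V)]_y \int[PX]_x f (x, y))%E.
Proof.
move=> h1 mf f0; rewrite (fubini_tonelli2 f mf f0); apply: eq_integral => y _.
by apply: eq_measure_integral => A mA _; exact: h1.
Qed.

Section information.
Variables (A0 A F : 'M[R]_L) (c : R).

(** Log-density at x of X given Y = y relative to [PX]: the sums are |F^-1 (x - A y)|^2 and |A0^-1
    x|^2, expanded into squares of linear forms to suit [integral_quadratic]. *)
Definition infodens (z : V * V) : R :=
  c - 2^-1 * (\sum_k lform (rowvec (invmx F) k) (rowvec (- (invmx F *m A)) k) z ^+ 2)
    + 2^-1 * (\sum_k lform (rowvec (invmx A0) k) zerov z ^+ 2).

Lemma measurable_infodens : measurable_fun setT infodens.
Proof.
apply: measurable_funD; last first.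
  apply: measurable_funM => //; apply: measurable_sum => k.
  by apply: measurable_funX; exact: measurable_lform.
apply: measurable_funB => //; apply: measurable_funM => //; apply: measurable_sum => k.
by apply: measurable_funX; exact: measurable_lform.
Qed.

Lemma infodensE x y : infodens (x, y) =
  c - 2^-1 * sqnorm (mulv (invmx F) (vadd (scalev (-1) (mulv A y)) x))
    + 2^-1 * sqnorm (mulv (invmx A0) x).
Proof.
rewrite /infodens /sqnorm; congr (_ - _ * _ + _ * _); apply: eq_bigr => k _.
  by rewrite /lform/= !dotv_rowvec mulvDr tnth_vadd mulvZ mulNv mulvM addrC.
by rewrite lform_fst dotv_rowvec.
Qed.

Hypothesis dens : forall (m : V) (f : V -> \bar R),
  measurable_fun setT f -> (forall x, 0 <= f x)%E ->
  (\int[G]_z f (vadd m (mulv F z)) =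
   \int[PX]_x (f x * (expR (c - 2^-1 * sqnorm (mulv (invmx F) (vadd (scalev (-1) m) x))
      + 2^-1 * sqnorm (mulv (invmx A0) x)))%:E))%E.

Lemma infodens_kernel y (f : V -> \bar R) :
  measurable_fun setT f -> (forall x, 0 <= f x)%E ->
  (\int[G]_g f (vadd (mulv A y) (mulv F g)) = \int[PX]_x (f x * (expR (infodens (x, y)))%:E))%E.
Proof.
by move=> mf f0; rewrite (dens (mulv A y) mf f0); apply: eq_integral => x _; rewrite infodensE.
Qed.

(* Gibbs' variational inequality: [expR infodens] integrates to 1 against the
   product of the marginals of any [pi] with first marginal [PX]. *)
Lemma mutinf_ge_infodens pi : has_fst PX pi -> pi.-integrable setT (EFin \o infodens) ->
  (\int[pi]_z (infodens z)%:E <= mutinf pi)%E.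
Proof.
move=> h1 iq; apply: KLdiv_ge => //; first exact: measurable_infodens.
have me : measurable_fun setT (fun z => (expR (infodens z))%:E : \bar R).
  by apply/measurable_EFinP; apply: measurableT_comp => //; exact: measurable_infodens.
have e0 z : (0 <= (expR (infodens z))%:E :> \bar R)%E by rewrite lee_fin expR_ge0.
rewrite (ge0_integral_prod_fst h1 me e0).
rewrite (eq_integral (cst 1%E)); last first.
  move=> y _; have := @infodens_kernel y (cst 1%E) (measurable_cst _) (fun=> lee01).
  under [X in _ = X -> _]eq_integral do rewrite mul1e.
  move=> <-; rewrite integral_cst// mul1e; exact: probability_setT.
by rewrite integral_cst// mul1e; apply: probability_le1.
Qed.

(** By [infodens_kernel], exp(infodens) is the density of each conditional law of X relative to
    [PX]; integrating over y makes it the density relative to the product of the marginals. *)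
Lemma mutinf_joint_law FK : has_fst PX (joint_law A FK F) ->
  mutinf (joint_law A FK F) = (\int[joint_law A FK F]_z (infodens z)%:E)%E.
Proof.
move=> h1; apply: KLdiv_density; first exact: measurable_infodens.
move=> E mE.
have mI : measurable_fun setT (fun z : V * V => (\1_E z)%:E : \bar R).
  by apply/measurable_EFinP; exact: measurable_indic.
have me : measurable_fun setT (fun z => (expR (infodens z))%:E : \bar R).
  by apply/measurable_EFinP; apply: measurableT_comp => //; exact: measurable_infodens.
rewrite integral_mkcond.
rewrite (eq_integral (fun z => ((\1_E z)%:E * (expR (infodens z))%:E)%E)); last first.
  by move=> z _; rewrite patchE indicE; case: ifP => _; rewrite ?mul1e ?mul0e.
have mIe : measurable_fun setT (fun z => (\1_E z)%:E * (expR (infodens z))%:E : \bar R)%E.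
  exact: emeasurable_funM.
have Ie0 z : (0 <= (\1_E z)%:E * (expR (infodens z))%:E :> \bar R)%E.
  by rewrite mule_ge0// lee_fin expR_ge0.
rewrite (ge0_integral_prod_fst h1 mIe Ie0).
have := @integral_indic _ _ _ (joint_law A FK F) setT measurableT _ mE; rewrite setIT => <-.
rewrite (ge0_integral_joint_law _ _ _ mI)//.
rewrite [RHS](@eq_measure_integral _ _ _ _ (linear_law FK)); last first.
  by move=> B mB _; exact: joint_law_snd.
apply: eq_integral => y _.
rewrite (@infodens_kernel y (fun x => (\1_E (x, y))%:E))//.
by apply: (measurableT_comp mI); exact: measurable_pair2.
Qed.

End information.

Section feasible_law.
Variables (pi : probability (V * V)%type R) (D : R).
Hypotheses (h1 : has_fst PX pi) (hD : (\int[pi]_z (sqdist z.1 z.2)%:E <= D%:E)%E).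
Notation v := (vform (momXX pi) (momXY pi) (momYY pi)).

(* A linear relation between the two components would make [pi] singular with
   respect to the product of its marginals, since a.X has no atoms. *)
Lemma residual_posdef A : A *m momYY pi = momXY pi -> mutinf pi != +oo%E ->
  forall a : V, (exists i, tnth a i != 0) -> 0 < quadform (residual_cov (momXX pi) (momYY pi) A) a.
Proof.
move=> AK Ifin a a0; rewrite lt_neqAle (quadform_residual _ AK) (mom_vform_ge0 S0 gX h1 hD) andbT.
set b := scalev _ _; apply/negP => /eqP vab.
have ml := measurable_lform a b.
pose H := [set z | lform a b z = 0].
have mH : measurable H.
  by rewrite -[H]setTI; exact: (ml measurableT _ (measurable_set1 0)).
have piH : pi H = 0%E.
  have /null_content_dominatesP := KLdiv_dominates Ifin; apply => //.
  have mIH : measurable_fun setT (fun z : V * V => (\1_H z)%:E : \bar R).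
    by apply/measurable_EFinP; exact: measurable_indic.
  have e := @integral_indic _ _ _ (distribution pi (@pfst _ _ V V) \x distribution pi (@psnd _ _ V V))%E setT measurableT _ mH.
  rewrite setIT in e; apply: (etrans (esym e)).
  rewrite (ge0_integral_prod_fst h1 mIH (fun z => ltac:(by rewrite lee_fin))).
  apply: integral0_eq => y _.
  have mHy : measurable [set x | dotv a x = - dotv b y].
    by rewrite -[X in measurable X]setTI; exact: (@measurable_dotvr R L a measurableT _ (measurable_set1 _)).
  have e2 := @integral_indic _ _ _ PX setT measurableT _ mHy; rewrite setIT in e2.
  apply: (etrans _ (etrans e2 (gaussian_vec_atom0 S0 gX _ a0))).
  apply: eq_integral => x _; rewrite !indicE; congr ((nat_of_bool _)%:R%:E).
  apply/idP/idP; rewrite !inE /H /lform/=; first by move/eqP; rewrite addr_eq0 => /eqP.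
  by move=> ->; rewrite addNr.
(* A linear form with zero second moment vanishes almost surely. *)
have piHC : pi (~` H) = 0%E.
  have := lform_sqr S0 gX h1 hD a b; rewrite -vab => i0.
  have ms : measurable_fun setT (fun z => (lform a b z ^+ 2)%:E : \bar R).
    by apply/measurable_EFinP; exact: measurable_funX.
  have : ae_eq pi setT (fun z => (lform a b z ^+ 2)%:E) (cst 0%E).
    apply/ae_eq_integral_abs => //; rewrite -[RHS]i0.
    by apply: eq_integral => z _; rewrite gee0_abs// lee_fin sqr_ge0.
  move=> [M [mM M0 sM]]; apply: (subset_measure0 _ mM _ M0); first exact: measurableC.
  apply: subset_trans sM => z Hz /= /(_ Logic.I) [] /eqP; rewrite sqrf_eq0 => /eqP.
  exact: Hz.
exact: (null_setC_contra mH piH piHC).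
Qed.

Lemma snd_sqr b : (\int[distribution pi (@psnd _ _ V V)]_y (dotv b y ^+ 2)%:E = (quadform (momYY pi) b)%:E)%E.
Proof.
rewrite -(mom_vform_snd pi b) -(lform_sqr S0 gX h1 hD).
rewrite ge0_integral_distribution; last 2 first.
- by apply/measurable_EFinP; apply: measurable_funX; exact: measurable_dotvr.
- by move=> y; rewrite lee_fin sqr_ge0.
by apply: eq_integral => z _; rewrite lform_snd.
Qed.

(** A relation b.Y = 0 would concentrate the second marginal on a hyperplane, which is null for
    [PX], against absolute continuity. *)
Lemma momYY_posdef : KLdiv (distribution pi (@psnd _ _ V V)) PX != +oo%E ->
  forall b : V, (exists i, tnth b i != 0) -> 0 < quadform (momYY pi) b.
Proof.
move=> Kfin b b0; rewrite lt_neqAle (momYY_ge0 S0 gX h1 hD) andbT; apply/negP => /eqP qb.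
pose PY : probability V R := distribution pi (@psnd _ _ V V).
pose H := [set y : V | dotv b y = 0].
have mH : measurable H.
  by rewrite -[H]setTI; exact: (@measurable_dotvr R L b measurableT _ (measurable_set1 _)).
have PH : PY H = 0%E.
  have /null_content_dominatesP := KLdiv_dominates Kfin; apply => //.
  exact: (gaussian_vec_atom0 S0 gX _ b0).
have PHC : PY (~` H) = 0%E.
  have := snd_sqr b; rewrite -qb => i0.
  have ms : measurable_fun setT (fun y : V => (dotv b y ^+ 2)%:E : \bar R).
    by apply/measurable_EFinP; apply: measurable_funX; exact: measurable_dotvr.
  have : ae_eq PY setT (fun y => (dotv b y ^+ 2)%:E) (cst 0%E).
    apply/ae_eq_integral_abs => //; rewrite -[RHS]i0.
    by apply: eq_integral => z _; rewrite gee0_abs// lee_fin sqr_ge0.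
  move=> [M [mM M0 sM]]; apply: (subset_measure0 _ mM _ M0); first exact: measurableC.
  apply: subset_trans sM => z Hz /= /(_ Logic.I) [] /eqP; rewrite sqrf_eq0 => /eqP.
  exact: Hz.
exact: (null_setC_contra mH PH PHC).
Qed.

End feasible_law.

End optimality.

(** * Comparison of a feasible law with its Gaussian counterpart *)

Section gaussian_optimal.
Context (R : realType) (L : nat) (SigmaX : 'M[R]_L).
Notation V := (vec R L).
Notation G := (@gaussv R L).
Variable (PX : probability V R).
Hypotheses (S0 : posdef SigmaX) (gX : gaussian_vec0 PX SigmaX).

Section fixed_law.
Variables (pi : probability (V * V)%type R) (D : R) (FK : 'M[R]_L).
Hypotheses (h1 : has_fst PX pi) (hD : (\int[pi]_z (sqdist z.1 z.2)%:E <= D%:E)%E).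
Notation v := (vform (momXX pi) (momXY pi) (momYY pi)).

Lemma joint_law_lform_sqr A F :
  (forall a b, gauss1 (pushforward (joint_law A FK F) (lform a b)) 0 (v a b)) ->
  forall a b, (\int[joint_law A FK F]_z (lform a b z ^+ 2)%:E = (v a b)%:E)%E.
Proof.
move=> g a b; apply: gauss1_sqr => //; first exact: measurable_lform.
exact: (mom_vform_ge0 S0 gX h1 hD).
Qed.

Lemma joint_law_sqdist A F :
  (forall a b, gauss1 (pushforward (joint_law A FK F) (lform a b)) 0 (v a b)) ->
  (\int[joint_law A FK F]_z (sqdist z.1 z.2)%:E = \int[pi]_z (sqdist z.1 z.2)%:E)%E.
Proof.
move=> g; rewrite (integral_sqdist (joint_law_lform_sqr g)).
by rewrite (integral_sqdist (lform_sqr S0 gX h1 hD)).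
Qed.

Lemma joint_law_mutinf A F : A *m momYY pi = momXY pi ->
  ((forall a : V, (exists i, tnth a i != 0) ->
     0 < quadform (residual_cov (momXX pi) (momYY pi) A) a) ->
      F \in unitmx /\ lebint_scaled F) ->
  has_fst PX (joint_law A FK F) ->
  (forall a b, gauss1 (pushforward (joint_law A FK F) (lform a b)) 0 (v a b)) ->
  mutinf pi != +oo%E -> (mutinf (joint_law A FK F) <= mutinf pi)%E.
Proof.
move=> AK FP hf g Ifin.
have [Fu Fs] := FP (residual_posdef S0 gX h1 hD AK Ifin).
have [A0 [A0u A0s PXE]] := gaussian_vec_linear_law S0 gX.
have [c dens] := gaussian_density PXE A0u A0s Fu Fs.
(* One polynomial and one table [v] of second moments, to be instantiated at both laws. *)
have quad (Q : probability (V * V)%type R) :=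
  @integral_quadratic _ _ _ Q L c
   (fun k => lform (rowvec (invmx F) k) (rowvec (- (invmx F *m A)) k))
   (fun k => lform (rowvec (invmx A0) k) zerov)
   (fun k => v (rowvec (invmx F) k) (rowvec (- (invmx F *m A)) k))
   (fun k => v (rowvec (invmx A0) k) zerov)
   (fun k => measurable_lform _ _) (fun k => measurable_lform _ _).
have [i1 e1] := quad pi (fun k => lform_sqr S0 gX h1 hD _ _) (fun k => lform_sqr S0 gX h1 hD _ _).
have [_ e2] := quad _ (fun k => joint_law_lform_sqr g _ _) (fun k => joint_law_lform_sqr g _ _).
rewrite (mutinf_joint_law dens hf).
rewrite [leLHS](_ : _ = \int[pi]_z (infodens A0 A F c z)%:E)%E; last first.
  by rewrite [LHS]e2 [RHS]e1.
exact: (mutinf_ge_infodens dens h1 i1).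
Qed.

Lemma joint_law_KLdiv A F :
  ((forall b : V, (exists i, tnth b i != 0) -> 0 < quadform (momYY pi) b) ->
      FK \in unitmx /\ lebint_scaled FK) ->
  (forall a b, gauss1 (pushforward (joint_law A FK F) (lform a b)) 0 (v a b)) ->
  KLdiv (distribution pi (@psnd _ _ V V)) PX != +oo%E ->
  (KLdiv (distribution (joint_law A FK F) (@psnd _ _ V V)) PX <=
   KLdiv (distribution pi (@psnd _ _ V V)) PX)%E.
Proof.
move=> FP g Kfin.
have [Fu Fs] := FP (momYY_posdef S0 gX h1 hD Kfin).
have [A0 [A0u A0s PXE]] := gaussian_vec_linear_law S0 gX.
have [c dens] := gaussian_density PXE A0u A0s Fu Fs.
have quad (Q : probability V R) :=
  @integral_quadratic _ _ _ Q L c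
   (fun k => dotv (rowvec (invmx FK) k)) (fun k => dotv (rowvec (invmx A0) k))
   (fun k => quadform (momYY pi) (rowvec (invmx FK) k))
   (fun k => quadform (momYY pi) (rowvec (invmx A0) k))
   (fun k => measurable_dotvr _) (fun k => measurable_dotvr _).
have sY b : (\int[distribution (joint_law A FK F) (@psnd _ _ V V)]_y (dotv b y ^+ 2)%:E =
    (quadform (momYY pi) b)%:E)%E.
  rewrite -(mom_vform_snd pi b) -(joint_law_lform_sqr g).
  rewrite ge0_integral_distribution; last 2 first.
  - by apply/measurable_EFinP; apply: measurable_funX; exact: measurable_dotvr.
  - by move=> y; rewrite lee_fin sqr_ge0.
  by apply: eq_integral => z _; rewrite lform_snd.
have [i1 e1] := quad (distribution pi (@psnd _ _ V V))
  (fun k => snd_sqr S0 gX h1 hD _) (fun k => snd_sqr S0 gX h1 hD _).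
have [_ e2] := quad (distribution (joint_law A FK F) (@psnd _ _ V V)) (fun k => sY _) (fun k => sY _).
set q := (fun y : V => c - 2^-1 * (\sum_k dotv (rowvec (invmx FK) k) y ^+ 2)
  + 2^-1 * (\sum_k dotv (rowvec (invmx A0) k) y ^+ 2)) in i1 e1 e2.
have mq : measurable_fun setT q.
  have ms M : measurable_fun setT (fun y : V => \sum_k dotv (rowvec M k) y ^+ 2).
    by apply: measurable_sum => k; apply: measurable_funX; exact: measurable_dotvr.
  by apply: measurable_funD; [apply: measurable_funB => //|]; apply: measurable_funM => //; exact: ms.
(* [gaussian_density] at mean 0: exp(q) is the density of the Gaussian second marginal relative to
   [PX]. *)
have densq (f : V -> \bar R) : measurable_fun setT f -> (forall x, 0 <= f x)%E ->
    (\int[G]_z f (mulv FK z) = \int[PX]_x (f x * (expR (q x))%:E))%E.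
  move=> mf f0; have := dens zerov f mf f0.
  have z0 (x : V) : vadd (scalev (-1) zerov) x = x.
    by apply: eq_from_tnth => i; rewrite tnth_vadd !tnth_mktuple mulr0 add0r.
  have z1 (x : V) : vadd zerov x = x.
    by apply: eq_from_tnth => i; rewrite tnth_vadd tnth_mktuple add0r.
  under eq_integral do rewrite z1.
  have sq M x : \sum_k dotv (rowvec M k) x ^+ 2 = sqnorm (mulv M x).
    by apply: eq_bigr => k _; rewrite dotv_rowvec.
  move=> h; apply: (etrans h); apply: eq_integral => x _.
  by rewrite z0 /q !sq.
have me : measurable_fun setT (fun x => (expR (q x))%:E : \bar R).
  by apply/measurable_EFinP; exact: measurableT_comp.
rewrite (@KLdiv_density _ _ _ _ _ q mq); last first.
  move=> B mB; rewrite integral_mkcond.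
  rewrite (eq_integral (fun x => ((\1_B x)%:E * (expR (q x))%:E)%E)); last first.
    by move=> x _; rewrite patchE indicE; case: ifP => _; rewrite ?mul1e ?mul0e.
  have mI : measurable_fun setT (fun x : V => (\1_B x)%:E : \bar R).
    by apply/measurable_EFinP; exact: measurable_indic.
  have I0 (x : V) : (0 <= (\1_B x)%:E :> \bar R)%E by rewrite lee_fin.
  rewrite -(densq _ mI I0) -(ge0_integral_law _ (measurable_mulv FK) mI I0).
  have e := @integral_indic _ _ _ (linear_law FK) setT measurableT _ mB; rewrite setIT in e.
  by apply: (etrans (joint_law_snd A FK F mB)); apply: esym.
rewrite e2 -e1; apply: KLdiv_ge => //.
have := densq (cst 1%E) (measurable_cst _) (fun=> lee01).
under [X in _ = X -> _]eq_integral do rewrite mul1e.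
by move=> <-; rewrite integral_cst// mul1e; apply: probability_le1.
Qed.

End fixed_law.

(** E[Y Y^T] depends on the second marginal only, so one factor [FK] fits both a feasible law and
    every coupling with its second marginal. *)
Lemma momYY_eq (pi ga : probability (V * V)%type R) (c c' : R) : has_fst PX pi -> has_fst PX ga ->
  (\int[pi]_z (sqdist z.1 z.2)%:E <= c%:E)%E -> (\int[ga]_z (sqdist z.1 z.2)%:E <= c'%:E)%E ->
  (forall A, measurable A -> distribution ga (@psnd _ _ V V) A = distribution pi (@psnd _ _ V V) A) ->
  momYY ga = momYY pi.
Proof.
move=> hp hg cp cg h; apply/matrixP => i j; rewrite !mxE /Rintegral; congr fine.
have mij : measurable_fun setT (fun y : V => (tnth y i * tnth y j)%:E : \bar R).
  by apply/measurable_EFinP; apply: measurable_funM; exact: measurable_tnthR.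
have ig := integrable_mul (sq_integrable_Y S0 gX hg cg i) (sq_integrable_Y S0 gX hg cg j).
have ip := integrable_mul (sq_integrable_Y S0 gX hp cp i) (sq_integrable_Y S0 gX hp cp j).
rewrite -[LHS](@integral_distribution _ _ _ _ _ ga (@psnd _ _ V V) (fun y => (tnth y i * tnth y j)%:E) mij ig).
rewrite -[RHS](@integral_distribution _ _ _ _ _ pi (@psnd _ _ V V) (fun y => (tnth y i * tnth y j)%:E) mij ip).
by apply: eq_measure_integral => A mA _; exact: h.
Qed.

(** A coupling of finite cost is itself a law with first marginal [PX] and finite distortion, so
    [gaussianize] applies to it. Reusing [FK] makes the result a coupling with the required second
    marginal, at the same cost. *)
Lemma gaussianize_W2sq pi D FK A F : has_fst PX pi ->
  (\int[pi]_z (sqdist z.1 z.2)%:E <= D%:E)%E -> FK *m FK^T = momYY pi ->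
  (W2sq PX (distribution (joint_law A FK F) (@psnd _ _ V V)) <=
   W2sq PX (distribution pi (@psnd _ _ V V)))%E.
Proof.
move=> h1 hD FKE; apply: le_ereal_inf_tmp => _ [ga [[cg1 cg2] ->]].
have [->|cfin] := eqVneq (\int[ga]_z (sqdist z.1 z.2)%:E)%E +oo%E; first exact: leey.
have c0 : (0 <= \int[ga]_z (sqdist z.1 z.2)%:E)%E.
  by apply: integral_ge0 => z _; rewrite lee_fin sqdist_ge0.
have hc : (\int[ga]_z (sqdist z.1 z.2)%:E <= (fine (\int[ga]_z (sqdist z.1 z.2)%:E))%:E)%E.
  by rewrite fineK// ge0_fin_numE// ltey.
have hg : has_fst PX ga by exact: cg1.
have FKE' : FK *m FK^T = momYY ga by rewrite FKE; apply/esym; exact: (momYY_eq h1 hg hD hc cg2).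
have [A' [F' [_ _ _ hf' g']]] := gaussianize S0 gX hg hc FKE'.
rewrite -(joint_law_sqdist hg hc g'); apply: ereal_inf_lbound.
exists (joint_law A' FK F'); split; last by [].
split; first exact: hf'.
move=> B mB; apply: (etrans (joint_law_snd A' FK F' mB)).
by apply/esym; exact: (joint_law_snd A FK F mB).
Qed.

Lemma gaussian_improves D P m pi : feasible PX D P m pi -> mutinf pi != +oo%E ->
  exists pi', (feasible PX D P m pi' /\ joint_gauss0 pi') /\ (mutinf pi' <= mutinf pi)%E.
Proof.
move=> [h1 [hD hP]] Ifin.
have [FK [FKE FKP]] := cholesky_vec (momYY_sym pi) (momYY_ge0 S0 gX h1 hD).
have [A [F [AK FE FP hf g]]] := gaussianize S0 gX h1 hD FKE.
exists (joint_law A FK F); split; last exact: (joint_law_mutinf h1 hD AK FP hf g Ifin).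
split; last by move=> a b; exists (vform (momXX pi) (momXY pi) (momYY pi) a b); split; [exact: (mom_vform_ge0 S0 gX h1 hD)|exact: g].
split; first exact: hf.
split; first by rewrite (joint_law_sqdist h1 hD g).
case: m hP => /= hP.
  (* The perception level [P] is a real number, so the constraint itself makes the divergence
     finite. *)
  have Kfin : KLdiv (distribution pi (@psnd _ _ V V)) PX != +oo%E.
    by apply/eqP => e; move: hP; rewrite e leye_eq.
  exact: le_trans (joint_law_KLdiv h1 hD FKP g Kfin) hP.
exact: le_trans (gaussianize_W2sq A F h1 hD FKE) hP.
Qed.

End gaussian_optimal.

Theorem theorem2 (R : realType) (L : nat) (SigmaX : 'M[R]_L)
    (PX : probability (vec R L) R) (D P : R) (m : perception) :
  posdef SigmaX -> gaussian_vec0 PX SigmaX -> 0 <= D -> 0 <= P ->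
  RDP PX D P m = RDP_gauss PX D P m.
Proof.
move=> S0 gX _ _; apply/eqP; rewrite eq_le; apply/andP; split.
  apply: le_ereal_inf_tmp => _ [pi [[fpi _] ->]].
  by apply: ereal_inf_lbound; exists pi.
apply: le_ereal_inf_tmp => _ [pi [fpi ->]].
(* A law of infinite information bounds nothing; only the others need a Gaussian competitor. *)
have [->|Ifin] := eqVneq (mutinf pi) +oo%E; first exact: leey.
have [pi' [fpi' le]] := gaussian_improves S0 gX fpi Ifin.
by apply: le_trans le; apply: ereal_inf_lbound; exists pi'.
Qed.
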